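(* Let $d\ge 2$ and let $\phi\in S^d\mathbb C^n$ be a polynomial of border rank three, $\underline{R}(\phi)=3$. Then there are linear forms $x,y,z\in\mathbb C^n$ (possibly linearly dependent) such that $\phi$ is equal to one of the following normal forms: (1) $x^d+y^d+z^d$; (2) $x^{d-1}y+z^d$; (3) $x^{d-2}y^2+x^{d-1}z$. Moreover, if $x,y,z$ are linearly independent, then the ranks satisfy: $R(\phi)=3$ in case (1); $d\le R(\phi)\le d+1$ in case (2); $d\le R(\phi)\le 2d-1$ in case (3).
   Context: $S^d\mathbb C^n$ denotes the space of complex homogeneous polynomials of degree $d$ in $n$ variables, and $\mathbb C^n=S^1\mathbb C^n$ is the space of linear forms. The rank $R(\phi)$ of $\phi\in S^d\mathbb C^n$ is the smallest $r$ such that $\phi=\ell_1^d+\cdots+\ell_r^d$ for linear forms $\ell_j\in\mathbb C^n$. The border rank $\underline{R}(\phi)$ is the smallest $r$ such that $\phi$ lies in the Zariski closure in $S^d\mathbb C^n$ of the set of polynomials of rank at most $r$. *)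

(* Defs.v *)
From HB Require Import structures.
From mathcomp Require Import all_boot all_order all_algebra.
From mathcomp Require Import reals complex.
From mathcomp Require Import mpoly.

Set Implicit Arguments.
Unset Strict Implicit.
Unset Printing Implicit Defensive.

Import GRing.Theory.

Local Open Scope ring_scope.

(* S^d K^n is the library type [dhomog n K d] of d-homogeneous polynomials in
   {mpoly K[n]}; the space K^n of linear forms is [dhomog n K 1]. *)

Definition is_least (P : nat -> Prop) (r : nat) : Prop :=
  P r /\ forall s, P s -> (r <= s)%N.

Section Rank.
Variables (K : fieldType) (n d : nat).
Implicit Types (phi psi : dhomog n K d) (A : dhomog n K d -> Prop).

Definition sum_of_powers phi (r : nat) : Prop :=
  exists l : 'I_r -> dhomog n K 1,
    (phi : {mpoly K[n]}) = \sum_(j < r) (l j : {mpoly K[n]}) ^+ d.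

(* Stated as a relation, so that no junk value is attached to polynomials that
   are not sums of d-th powers. *)
Definition is_rank phi (r : nat) : Prop := is_least (sum_of_powers phi) r.

Definition rank_at_most (r : nat) phi : Prop :=
  exists2 s, (s <= r)%N & is_rank phi s.

Definition monom : finType := {m : 'X_{1..n < d.+1} | mdeg m == d}.

(* Coordinates of S^d K^n in the basis of monomials of degree d. *)
Definition coords phi (i : 'I_#|{: monom}|) : K :=
  (phi : {mpoly K[n]})@_(val (enum_val i)).

(* The common zeros of all polynomial functions on S^d K^n vanishing on A. *)
Definition zariski_closure A phi : Prop :=
  forall P : {mpoly K[#|{: monom}|]},
    (forall psi, A psi -> P.@[coords psi] = 0) -> P.@[coords phi] = 0.

Definition is_border_rank phi (r : nat) : Prop :=
  is_least (fun s => zariski_closure (rank_at_most s) phi) r.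

End Rank.

(* [free] is not available for [dhomog n K 1], which is a vectType only when n
   is syntactically a successor. *)
Definition lin_indep3 (K : fieldType) (V : lmodType K) (x y z : V) : Prop :=
  forall a b c : K,
    a *: x + b *: y + c *: z = 0 -> [/\ a = 0, b = 0 & c = 0].

Section NormalForms.
Variables (K : fieldType) (n d : nat).
Implicit Types x y z : dhomog n K 1.

Definition nf1 x y z : {mpoly K[n]} :=
  (x : {mpoly K[n]}) ^+ d + (y : {mpoly K[n]}) ^+ d + (z : {mpoly K[n]}) ^+ d.

Definition nf2 x y z : {mpoly K[n]} :=
  (x : {mpoly K[n]}) ^+ (d - 1) * y + (z : {mpoly K[n]}) ^+ d.

Definition nf3 x y z : {mpoly K[n]} :=
  (x : {mpoly K[n]}) ^+ (d - 2) * (y : {mpoly K[n]}) ^+ 2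
  + (x : {mpoly K[n]}) ^+ (d - 1) * z.

End NormalForms.

(* Main.v *)
(** Since [phi] lies in the closure of the sums of three [d]-th powers,
    evaluation at [phi] extends (Chevalley) to a place, i.e. a residue map
    defined on a valuation ring, of the field [F] generated by the coefficients
    of three generic linear forms [L1, L2, L3]: thus [phi] is the reduction of
    [L1^d + L2^d + L3^d].  Scale the [Lj] to primitive forms [P, P2, P3].
    - If their reductions are pairwise non-proportional, the reductions of the
      [d]-th powers are independent, and [phi] lies in their span.
    - If [P] and [P2 = P + s Q] have the same reduction [x], replace [P2^d]
      by the difference quotient [(P2^d - P^d) / s], which reduces to
      [d x^(d-1) q].
    - If moreover [P3 = P + s W], write [W = la Q + t U] with [U] primitive; the
      second difference [(P3^d - P^d) / s - la (P2^d - P^d) / s] has the form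
      [t C1 + s la (la - 1) C2], where [C1] reduces to [d x^(d-1) u] and [C2] to
      a nonzero multiple of [x^(d-2) q^2].
    In each case the new generators have independent reductions, whose span
    consists of normal forms.  The ranks reduce to binary forms: apolarity gives
    the lower bound [d] for [x^(d-1) y], and Vandermonde systems the explicit
    decompositions. *)

Require Import Defs.
From HB Require Import structures.
From mathcomp Require Import all_boot all_order all_algebra.
From mathcomp Require Import ring.
From mathcomp Require Import reals complex.
From mathcomp Require Import mpoly.
From mathcomp Require classical_sets boolp.

Set Implicit Arguments.
Unset Strict Implicit.
Unset Printing Implicit Defensive.

Import GRing.Theory Num.Theory.
Local Open Scope ring_scope.

(** * Places *)

(* [G a c] reads: [a] belongs to the subring and its residue is [c].  As the
   graph [G] contains the constants, [~ G 0 1] makes it single-valued. *)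
Record partial_place (K F : fieldType) (iota : {rmorphism K -> F})
    (G : F -> K -> Prop) : Prop := PartialPlace {
  plC : forall c, G (iota c) c;
  plD : forall a b c e, G a c -> G b e -> G (a + b) (c + e);
  plM : forall a b c e, G a c -> G b e -> G (a * b) (c * e);
  pl01 : ~ G 0 1 }.

(* The subring is a valuation ring with residue field [K]. *)
Definition place (K F : fieldType) (iota : {rmorphism K -> F})
    (G : F -> K -> Prop) : Prop :=
  partial_place iota G /\ forall x, (exists c, G x c) \/ G x^-1 0.

Section PartialPlace.
Variables (K F : fieldType) (iota : {rmorphism K -> F}) (G : F -> K -> Prop).
Hypothesis plG : partial_place iota G.

Lemma pl0 : G 0 0. Proof. by have := plC plG 0; rewrite rmorph0. Qed.
Lemma pl1 : G 1 1. Proof. by have := plC plG 1; rewrite rmorph1. Qed.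

Lemma plN a c : G a c -> G (- a) (- c).
Proof.
move=> Gac; have := plM plG (plC plG (-1)) Gac.
by rewrite rmorphN1 !mulN1r.
Qed.

Lemma plB a b c e : G a c -> G b e -> G (a - b) (c - e).
Proof. by move=> Ga Gb; apply: plD plG _ _ _ _ Ga (plN Gb). Qed.

Lemma plX a c k : G a c -> G (a ^+ k) (c ^+ k).
Proof.
move=> Ga; elim: k => [|k IH]; first by rewrite !expr0; exact: pl1.
by rewrite !exprS; apply: (plM plG).
Qed.

Lemma pl_sum (I : Type) (r : seq I) (P : pred I) (f : I -> F) (g : I -> K) :
  (forall i, G (f i) (g i)) ->
    G (\sum_(i <- r | P i) f i) (\sum_(i <- r | P i) g i).
Proof.
move=> fg; elim/big_rec2: _ => [|i a c _ IH]; first exact: pl0.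
exact: (plD plG).
Qed.

Lemma pl_inj a c e : G a c -> G a e -> c = e.
Proof.
move=> Gc Ge; apply/eqP; rewrite -subr_eq0; apply/negP => /negP nz.
apply: (pl01 plG); have := plM plG (plC plG (c - e)^-1) (plB Gc Ge).
by rewrite subrr mulr0 mulVf.
Qed.

Definition pl_poly (P : {poly F}) (p : {poly K}) : Prop :=
  forall i, G P`_i p`_i.

Lemma pl_polyC a c : G a c -> pl_poly a%:P c%:P.
Proof. by move=> Gac i; rewrite !coefC; case: (i == 0); last exact: pl0. Qed.

Lemma pl_polyD P Q p q :
  pl_poly P p -> pl_poly Q q -> pl_poly (P + Q) (p + q).
Proof. by move=> PG QG i; rewrite !coefD; apply: (plD plG). Qed.

Lemma pl_polyB P Q p q :
  pl_poly P p -> pl_poly Q q -> pl_poly (P - Q) (p - q).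
Proof. by move=> PG QG i; rewrite !coefB; apply: plB. Qed.

Lemma pl_polyM P Q p q :
  pl_poly P p -> pl_poly Q q -> pl_poly (P * Q) (p * q).
Proof.
by move=> PG QG i; rewrite !coefM; apply: pl_sum => j; apply: (plM plG).
Qed.

Lemma pl_polyXn k : pl_poly 'X^k 'X^k.
Proof.
by move=> i; rewrite !coefXn; case: (i == k); [exact: pl1 | exact: pl0].
Qed.

Lemma pl_poly_const (p : {poly K}) : pl_poly (map_poly iota p) p.
Proof. by move=> i; rewrite coef_map; apply: (plC plG). Qed.

End PartialPlace.

Lemma exprMVB (F : fieldType) (y : F) n i :
  y != 0 -> (i <= n)%N -> y ^+ n * y^-1 ^+ i = y ^+ (n - i).
Proof.
by move=> y0 le; rewrite -{1}(subnK le) exprD -mulrA -exprMn divff ?expr1n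
  ?mulr1.
Qed.

(** * Maximal partial places and Chevalley's extension theorem *)

Section MaximalPlace.
Variables (K : closedFieldType) (F : fieldType) (iota : {rmorphism K -> F}).
Variable (G : F -> K -> Prop).
Hypothesis plG : partial_place iota G.
Hypothesis maxG : forall G' : F -> K -> Prop, partial_place iota G' ->
  (forall a c, G a c -> G' a c) -> forall a c, G' a c -> G a c.

(* Adjoining [x] with residue [al] to a maximal place can only fail because of
   an algebraic relation on [x] that is violated by [al]. *)
Lemma maximal_adjoin x al : ~ G x al ->
  exists P p, [/\ pl_poly G P p, P.[x] = 0 & p.[al] = 1].
Proof.
move=> nG; apply: boolp.contrapT => nE; apply: nG.
pose G' a c := exists P p, [/\ pl_poly G P p, a = P.[x] & c = p.[al]].
apply: (maxG (G' := G')).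
- split.
  + move=> c; exists (iota c)%:P, c%:P; split; rewrite ?hornerC //.
    exact: (pl_polyC plG (plC plG c)).
  + move=> _ _ _ _ [P [p [Pp -> ->]]] [Q [q [Qq -> ->]]].
    by exists (P + Q), (p + q); split; rewrite ?hornerD //;
      apply: (pl_polyD plG).
  + move=> _ _ _ _ [P [p [Pp -> ->]]] [Q [q [Qq -> ->]]].
    by exists (P * Q), (p * q); split; rewrite ?hornerM //;
      apply: (pl_polyM plG).
  + by move=> [P [p [Pp Px pal]]]; apply: nE; exists P, p.
- move=> a c Gac; exists a%:P, c%:P; split; rewrite ?hornerC //.
  exact: (pl_polyC plG Gac).
exists 'X, 'X; split; rewrite ?hornerX //.
by have := pl_polyXn plG 1; rewrite !expr1.
Qed.

(** Otherwise some [P] kills [a^-1] while its reduction is 1 at [c^-1]. Multiplying by [a ^+ n]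
    clears denominators and gives 0 the residue [c ^+ n], hence, after scaling, the residue 1. *)
Lemma maximal_inv a c : G a c -> c != 0 -> G a^-1 c^-1.
Proof.
move=> Gac c0; have a0 : a != 0.
  by apply: contra c0 => /eqP a0; apply/eqP/(pl_inj plG Gac); rewrite a0;
    exact: pl0 plG.
apply: boolp.contrapT => /maximal_adjoin [P [p [Pp Pa pc]]].
pose n := maxn (size P) (size p).
have rev (L : fieldType) (R : {poly L}) (y : L) : y != 0 -> (size R <= n)%N ->
    \sum_(i < n) R`_i * y ^+ (n - i) = y ^+ n * R.[y^-1].
  move=> y0 sR; rewrite (horner_coef_wide _ sR) mulr_sumr.
  apply: eq_bigr => i _; rewrite mulrCA; congr (_ * _).
  by rewrite exprMVB // ltnW.
have := pl_sum plG (index_enum 'I_n) xpredT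
   (fun i : 'I_n => plM plG (Pp i) (plX plG (n - i) Gac)).
rewrite !rev ?leq_maxl ?leq_maxr // Pa pc mulr0 mulr1 => G0.
apply: (pl01 plG); have := plM plG (plC plG (c ^- n)) G0.
by rewrite mulr0 mulVf ?expf_neq0.
Qed.

(** The reductions of the polynomials killing [x] form an ideal of [K[X]]. By [maximal_adjoin] it
    has no common zero, so over an algebraically closed field it contains 1. *)
Lemma maximal_relation x : (forall c, ~ G x c) ->
  exists P p, [/\ pl_poly G P p, P.[x] = 0 & p = 1].
Proof.
move=> nG; pose I p := exists2 P, pl_poly G P p & P.[x] = 0.
have exI al : exists p, I p /\ p.[al] = 1.
  by have [P [p [Pp Px pal]]] := maximal_adjoin (nG al); exists p; split=> //;
    exists P.
have [p0 [Ip0 p01]] := exI 0.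
have p0n0 : p0 != 0 by apply/eqP => p00; move: p01;
  rewrite p00 horner0 => /esym/eqP; rewrite oner_eq0.
have exs : exists k, boolp.asbool (exists p, [/\ I p, p != 0 & size p = k]).
  by exists (size p0); apply/boolp.asboolP; exists p0.
case: (ex_minnP exs) => k /boolp.asboolP [p [Ip pn0 <-]] min {exs k}.
have [|s1] := leqP (size p) 1.
  move=> s1; have [c cE] : exists c, p = c%:P by exists p`_0;
    exact: size1_polyC.
  have c0 : c != 0 by apply: contra pn0 => /eqP c0; rewrite cE c0.
  case: Ip => P Pp Px; exists ((iota c^-1)%:P * P), (c^-1%:P * p); split.
  - by apply: (pl_polyM plG) => //; apply: (pl_polyC plG); exact: (plC plG).
  - by rewrite hornerM Px mulr0.
  - by rewrite cE -polyCM mulVf.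
(* A root [al] of the smallest member [p] is impossible: some [q] in the ideal has value 1 at [al],
   yet its remainder modulo [p] is again in the ideal and vanishes by minimality. *)
have /closed_rootP [al /rootP pal] : size p != 1 by rewrite neq_ltn s1 orbT.
have [q [[Q Qq Qx] qal]] := exI al.
suff /eqP r0 : q %% p == 0.
  have := qal; rewrite (divp_eq q p) r0 addr0 hornerM pal mulr0 => /esym/eqP.
  by rewrite oner_eq0.
apply: contraT => rn0; have := ltn_modp q p; rewrite pn0 => lt.
suff /min : boolp.asbool (exists p1, [/\ I p1,
  p1 != 0 & size p1 = size (q %% p)]).
  by rewrite leqNgt lt.
apply/boolp.asboolP; exists (q %% p); split=> //.
case: Ip => P Pp Px; exists (Q - map_poly iota (q %/ p) * P).
  have -> : q %% p = q - q %/ p * p by rewrite {2}(divp_eq q p) addrAC subrr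
    add0r.
  apply: (pl_polyB plG) => //.
  by apply: (pl_polyM plG) => //; exact: pl_poly_const plG _.
by rewrite hornerD hornerN hornerM Qx Px mulr0 subrr.
Qed.

(* The degree reduction of the classical proof that maximal places have
   valuation rings: [P] kills [x], [Q] kills [x^-1], both reduce to [1]. *)
Lemma no_opposite_relations n (P Q : {poly F}) (x : F) : x != 0 ->
  (size P + size Q <= n)%N ->
  pl_poly G P 1 -> pl_poly G Q 1 -> P.[x] = 0 -> Q.[x^-1] = 0 -> False.
Proof.
elim: n P Q x => [|n IH] P Q x x0.
  rewrite leqn0 addn_eq0 => /andP[/eqP sP _] Pp.
  by have := Pp 0%N; rewrite nth_default ?sP // coef1 => /(pl01 plG).
wlog le : P Q x x0 / (size Q <= size P)%N.
  move=> W; have [le|/ltnW le] := leqP (size Q) (size P); first exact: W.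
  move=> s Pp Qp Px Qx; apply: (W Q P x^-1) => //; rewrite ?invr_eq0 ?invrK //.
  by rewrite addnC.
move=> s Pp Qp Px Qx.
have noC (R : {poly F}) y : pl_poly G R 1 -> R.[y] = 0 -> (1 < size R)%N.
  move=> Rp Ry; rewrite ltnNge; apply/negP => s1.
  have := Rp 0%N; rewrite coef1; move: Ry.
  by rewrite (size1_polyC s1) hornerC coefC => -> /(pl01 plG).
have sP := noC _ _ Pp Px; have sQ := noC _ _ Qp Qx.
set m := (size Q).-1; set k := (size P).-1.
have km : (m <= k)%N by rewrite /m /k -!subn1 leq_sub2r.
have G0V : G (Q`_0)^-1 1.
  by have := maximal_inv (Qp 0%N); rewrite coef1 invr1; apply; exact: oner_neq0.
have Q0 : Q`_0 != 0.
  apply/eqP => e; have := Qp 0%N; rewrite coef1 e; exact: (pl01 plG).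
pose Qr := \poly_(i < m.+1) Q`_(m - i).
have Qrx : Qr.[x] = 0.
  have sQr : size Q = m.+1 by rewrite prednK // (ltn_trans _ sQ).
  rewrite horner_poly; have := Qx;
    rewrite horner_coef sQr => /(congr1 ( *%R (x ^+ m))).
  rewrite mulr0 mulr_sumr (reindex_inj rev_ord_inj) /= => E; rewrite -[RHS]E.
  apply: eq_bigr => i _; rewrite !subSS mulrCA; congr (_ * _).
  by rewrite exprMVB ?leq_subr // subKn // -ltnS.
(* The reversal [Qr] kills [x] and its top coefficient is the constant coefficient of [Q], so [al]
   is chosen to cancel the leading term of [P]. As [P] reduces to 1 and [k] is positive, [al] has
   residue 0, and [P'] still reduces to 1. *)
pose al := P`_k / Q`_0.
have Gal : G al 0.
  have := Pp k; rewrite coef1;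
    have -> : (k == 0)%N = false by rewrite /k -subn1 subn_eq0 leqNgt sP.
  by move=> Gk; have := plM plG Gk G0V; rewrite mul0r.
pose P' := P - al%:P * 'X^(k - m) * Qr.
have cP' i : P'`_i = P`_i - al * (if (i < k - m)%N then 0 else Qr`_(i - (k -
  m))).
  by rewrite coefB -mulrA coefCM coefXnM.
have P'p : pl_poly G P' 1.
  pose r : {poly K} := \poly_(i < m.+1) (1 : {poly K})`_(m - i).
  have -> : (1 : {poly K}) = 1 - 0%:P * 'X^(k - m) * r.
    by rewrite polyC0 !mul0r subr0.
  apply: (pl_polyB plG) => //; apply: (pl_polyM plG).
    by apply: (pl_polyM plG); [exact: (pl_polyC plG) | exact: (pl_polyXn plG)].
  by move=> i; rewrite !coef_poly; case: ifP => _; [exact: Qp | exact: pl0 plG].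
have sP' : (size P' <= k)%N.
  apply/leq_sizeP => j; rewrite leq_eqVlt => /orP[/eqP <-|kj]; rewrite cP'.
    rewrite ltnNge leq_subr /= subKn // coef_poly ltnSn subnn /al divfK //.
    by rewrite subrr.
  rewrite nth_default; last by rewrite -(prednK (ltnW sP)).
  rewrite ltnNge (leq_trans (leq_subr _ _) (ltnW kj)) /= coef_poly.
  by rewrite ltnNge ltn_subRL subnK // kj /= mulr0 subrr.
apply: (IH P' Q x) => //.
  rewrite -ltnS; apply: leq_trans s; rewrite -addSn leq_add2r.
  by apply: leq_ltn_trans sP' _; rewrite /k prednK // ltnW.
by rewrite hornerD hornerN !hornerM Px Qrx mulr0 subrr.
Qed.

Lemma maximal_place : place iota G.
Proof.
split=> // x; have [->|x0] := eqVneq x 0; first by left; exists 0;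
  exact: pl0 plG.
have [[c Gc]|nc] := boolp.EM (exists c, G x c); first by left; exists c.
have [[c Gc]|nd] := boolp.EM (exists c, G x^-1 c).
  have [c0|c0] := eqVneq c 0; first by right; rewrite -c0.
  by left; exists c^-1; rewrite -[x]invrK; apply: maximal_inv.
have [P [p [Pp Px p1]]] : exists P p, [/\ pl_poly G P p, P.[x] = 0 & p = 1].
  by apply: maximal_relation => c Gc; apply: nc; exists c.
have [Q [q [Qq Qx q1]]] : exists P p, [/\ pl_poly G P p, P.[x^-1] = 0 & p = 1].
  by apply: maximal_relation => c Gc; apply: nd; exists c.
exfalso; apply: (no_opposite_relations (n :=
  size P + size Q) x0 _ _ _ Px Qx) => //.
- by rewrite -p1.
- by rewrite -q1.
Qed.

End MaximalPlace.

Lemma place_extension (K : closedFieldType) (F : fieldType)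
    (iota : {rmorphism K -> F}) (G0 : F -> K -> Prop) :
  partial_place iota G0 ->
  exists2 G, place iota G & forall a c, G0 a c -> G a c.
Proof.
move=> pl0.
pose U (G : F -> K -> Prop) : classical_sets.set (F * K) :=
  fun ac => G ac.1 ac.2.
pose C (A : classical_sets.set (F * K)) : F -> K -> Prop := fun a c => A (a, c).
pose good A := partial_place iota (C A) /\ forall a c, G0 a c -> C A a c.
pose P A := (forall z, ~ A z) \/ good A.
have [|A [PA maxA]] := @classical_sets.Zorn_bigcup _ P.
  move=> H HP Htot.
  have [[A0 [HA0 gA0]]|nex] := boolp.EM (exists A, H A /\ good A); last first.
    left=> z [A HA Az]; apply: nex; exists A; split=> //.
    by case: (HP _ HA) => // /(_ z).
  right.
  have goodz A z : H A -> A z -> good A by move=> HA Az;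
    case: (HP _ HA) => // /(_ z).
  have both A B z w : H A -> H B -> A z -> B w ->
      exists D, [/\ H D, good D, D z & D w].
    move=> HA HB Az Bw; have gA := goodz _ _ HA Az; have gB := goodz _ _ HB Bw.
    case: (Htot _ _ HA HB) => s.
      by exists B; split=> //; apply: s.
    by exists A; split=> //; apply: s.
  split; last by move=> a c G0ac; exists A0 => //; apply: gA0.2.
  split.
  - by move=> c; exists A0 => //; apply: (plC gA0.1).
  - move=> a b c e [A HA Az] [B HB Bz].
    have [D [HD gD Dz Dw]] := both _ _ _ _ HA HB Az Bz.
    by exists D => //; apply: (plD gD.1).
  - move=> a b c e [A HA Az] [B HB Bz].
    have [D [HD gD Dz Dw]] := both _ _ _ _ HA HB Az Bz.
    by exists D => //; apply: (plM gD.1).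
  - by move=> [A HA Az]; have gA := goodz _ _ HA Az; apply: (pl01 gA.1).
have goodA : good A.
  case: PA => // A0; exfalso; apply: (maxA (U G0)); last by right; split.
  split; first by move=> z /A0.
  by move=> s; apply: (A0 (iota 0, 0)); apply: s; apply: (plC pl0).
exists (C A); last exact: goodA.2.
apply: maximal_place; first exact: goodA.1.
move=> G' plG' sub a c G'ac; apply: boolp.contrapT => nA.
apply: (maxA (U G')); last first.
  by right; split=> // b e /goodA.2; apply: sub.
by split=> [[b e] /sub //|s]; apply: nA; apply: (s (a, c)).
Qed.

(** * Linear forms *)

Definition linform (R : comNzRingType) (n : nat) (a : 'I_n ->
  R) : {mpoly R[n]} :=
  \sum_i a i *: 'X_i.

Section LinearForms.
Variables (R : comNzRingType) (n : nat).
Implicit Types (a b v w : 'I_n -> R) (p q : {mpoly R[n]}).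

Lemma linform_meval a v : (linform a).@[v] = \sum_i a i * v i.
Proof. by rewrite raddf_sum; apply: eq_bigr => i _ /=; rewrite mevalZ mevalXU.
  Qed.

Lemma linform_coef a i : (linform a)@_U_(i) = a i.
Proof.
rewrite raddf_sum (bigD1 i) //= mcoeffZ mcoeffXU eqxx mulr1 big1 ?addr0 // => j
  ji.
by rewrite mcoeffZ mcoeffXU (negPf ji) mulr0.
Qed.

Lemma eq_linform a b : a =1 b -> linform a = linform b.
Proof. by move=> ab; apply: eq_bigr => i _; rewrite ab. Qed.

Lemma linformD a b : linform (fun i => a i + b i) = linform a + linform b.
Proof. by rewrite -big_split; apply: eq_bigr => i _ /=; rewrite scalerDl. Qed.

Lemma linformZ c a : linform (fun i => c * a i) = c *: linform a.
Proof. by rewrite scaler_sumr; apply: eq_bigr => i _; rewrite scalerA. Qed.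

Lemma linform0 a : (forall i, a i = 0) -> linform a = 0.
Proof. by move=> a0; rewrite /linform big1 // => i _; rewrite a0 scale0r. Qed.

Lemma linform_homog a : linform a \is 1.-homog.
Proof.
by apply: rpred_sum => i _; apply: dhomogZ; rewrite dhomogX /= mdeg1.
Qed.

Lemma homog1_linform p : p \is 1.-homog -> p = linform (fun i => p@_U_(i)).
Proof.
move=> hp; apply/mpolyP => m.
have [m1|m1] := eqVneq (mdeg m) 1%N; last first.
  by rewrite !(dhomog_nemf_coeff _ m1) ?linform_homog.
by have /eqP/mdeg1P [i /eqP ->] := m1; rewrite linform_coef.
Qed.

Definition dirderiv v p : {mpoly R[n]} := \sum_i v i *: p^`M(i).

Lemma dirderivD v p q : dirderiv v (p + q) = dirderiv v p + dirderiv v q.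
Proof.
by rewrite -big_split; apply: eq_bigr => i _ /=; rewrite mderivD scalerDr.
Qed.

Lemma dirderivZ v c p : dirderiv v (c *: p) = c *: dirderiv v p.
Proof.
by rewrite scaler_sumr; apply: eq_bigr => i _; rewrite mderivZ !scalerA mulrC.
Qed.

Lemma dirderivM v p q : dirderiv v (p * q) = dirderiv v p * q + p * dirderiv v
  q.
Proof.
rewrite mulr_suml mulr_sumr -big_split; apply: eq_bigr => i _ /=.
by rewrite mderivM scalerDr scalerAl scalerAr.
Qed.

Lemma dirderivC v c : dirderiv v c%:MP = 0.
Proof. by apply: big1 => i _; rewrite mderivC scaler0. Qed.

Lemma dirderiv0 v : dirderiv v 0 = 0.
Proof. by rewrite -[0]/(0%:MP) dirderivC. Qed.

Lemma dirderivX v p k : dirderiv v (p ^+ k.+1) = k.+1%:R *: (dirderiv v p * p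
  ^+ k).
Proof.
elim: k => [|k IH]; first by rewrite expr1 expr0 mulr1 scale1r.
rewrite exprS dirderivM IH -scalerAr mulrCA -exprS -[k.+2]add1n natrD.
by rewrite scalerDl scale1r.
Qed.

Lemma dirderiv_linform v a : dirderiv v (linform a) = ((linform a).@[v])%:MP.
Proof.
rewrite linform_meval rmorph_sum /=; apply: eq_bigr => i _.
rewrite /linform (raddf_sum (mderiv i)) /= (bigD1 i) //= big1 ?addr0.
  have UU : (U_(i) - U_(i))%MM = 0%MM :> 'X_{1..n}.
    by apply/mnmP => k; rewrite mnmBE subnn mnmE.
  rewrite mderivZ mderivX mnm1E eqxx scale1r UU mpolyX0 scalerA alg_mpolyC.
  by rewrite mulrC.
move=> j ji; rewrite mderivZ mderivX mnm1E (negPf ji) scale0r scaler0 //.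
Qed.

(** Two derivatives turn a power of a linear form into a multiple of a lower power, with the values
    of the form at [v] and [w] as factors. A suitable choice of [v] and [w] thus kills chosen terms
    of a relation. *)
Lemma dirderiv2_relation v w (a b c : R) p q r p' q' r' :
  dirderiv w (dirderiv v p) = p' -> dirderiv w (dirderiv v q) = q' ->
  dirderiv w (dirderiv v r) = r' -> a *: p + b *: q + c *: r = 0 ->
  a *: p' + b *: q' + c *: r' = 0.
Proof.
move=> <- <- <- E.
by rewrite -!dirderivZ -!dirderivD E !dirderiv0.
Qed.

Lemma dirderiv2_linformX v w a d :
  dirderiv w (dirderiv v (linform a ^+ d.+2)) =
  (d.+2%:R * d.+1%:R * (linform a).@[v] * (linform a).@[w]) *: linform a ^+ d.
Proof.
rewrite dirderivX dirderiv_linform mul_mpolyC scalerA dirderivZ dirderivX.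
rewrite dirderiv_linform mul_mpolyC !scalerA; congr (_ *: _); ring.
Qed.

(** Along a zero [v] of [x] only the factor [y] varies, and it does so linearly. *)
Lemma dirderiv2_tangent v x y d : (linform x).@[v] = 0 ->
  dirderiv v (dirderiv v (linform x ^+ d.+1 * linform y)) = 0.
Proof.
move=> xv; have dX0 k : dirderiv v (linform x ^+ k.+1) = 0.
  by rewrite dirderivX dirderiv_linform xv mpolyC0 mul0r scaler0.
by rewrite dirderivM dX0 mul0r add0r dirderivM dX0 dirderiv_linform dirderivC
  mul0r mulr0 addr0.
Qed.

End LinearForms.

Definition unitvec (R : comNzRingType) (n : nat) (i j : 'I_n) : R :=
  (i == j)%:R.

Lemma linform_unitvec (R : comNzRingType) n (a : 'I_n -> R) i :
  (linform a).@[unitvec R i] = a i.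
Proof.
rewrite linform_meval (bigD1 i) //= /unitvec eqxx mulr1 big1 ?addr0 // => j ji.
by rewrite eq_sym (negPf ji) mulr0.
Qed.

(** * Independence of powers, tangent terms and osculating terms *)

Section Independence.
Variables (K : numFieldType) (n : nat).
Implicit Types (a b c v w x y z : 'I_n -> K).

Lemma linform_neq0 a v : (linform a).@[v] != 0 -> linform a != 0.
Proof. by apply: contra => /eqP ->; rewrite meval0. Qed.

(** Differentiating along [v] and [w] kills the first two terms and, in characteristic 0, leaves a
    nonzero multiple of [ga *: linform c ^+ d]. *)
Lemma powers_indep a b c v w al be ga d :
  (linform a).@[v] = 0 -> (linform b).@[w] = 0 ->
  (linform c).@[v] != 0 -> (linform c).@[w] != 0 ->
  al *: linform a ^+ d.+2 + be *: linform b ^+ d.+2 + ga *: linform c ^+ d.+2 =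
    0 ->
  ga = 0.
Proof.
move=> av bw cv cw /(dirderiv2_relation (dirderiv2_linformX v w a d)
  (dirderiv2_linformX v w b d) (dirderiv2_linformX v w c d)).
rewrite av bw.
rewrite !mulr0 !mul0r !scale0r !scaler0 !add0r scalerA => /eqP.
rewrite scaler_eq0 expf_eq0 (negPf (linform_neq0 cv)) andbF orbF.
by rewrite !mulf_eq0 !pnatr_eq0 (negPf cv) (negPf cw) !orbF => /eqP.
Qed.

Lemma power_tangent_indep x y z v al be ga d :
  (linform x).@[v] = 0 -> (linform z).@[v] != 0 ->
  al *: linform x ^+ d.+2 + be *: (linform x ^+ d.+1 * linform y)
    + ga *: linform z ^+ d.+2 = 0 -> ga = 0.
Proof.
move=> xv zv /(dirderiv2_relation (dirderiv2_linformX v v x d)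
  (dirderiv2_tangent y d xv) (dirderiv2_linformX v v z d)).
rewrite xv !mulr0 scale0r !scaler0 !add0r scalerA => /eqP.
rewrite scaler_eq0 expf_eq0 (negPf (linform_neq0 zv)) andbF orbF.
by rewrite !mulf_eq0 !pnatr_eq0 (negPf zv) !orbF => /eqP.
Qed.

Lemma tangent_indep x y al be i d : x i = 1 -> y i = 0 ->
  al *: linform x ^+ d.+2 + be *: (linform x ^+ d.+1 * linform y) = 0 ->
  al = 0 /\ (linform y != 0 -> be = 0).
Proof.
move=> xi yi E; have al0 : al = 0.
  have := congr1 (meval (unitvec K i)) E; rewrite mevalD !mevalZ mevalM.
  rewrite !rmorphXn /= !linform_unitvec xi yi !expr1n meval0.
  by rewrite !mulr0 addr0 mulr1.
split=> // y0; move/eqP: E;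
  rewrite al0 scale0r add0r scaler_eq0 => /orP[/eqP//|].
have x0 : linform x != 0 by apply: (@linform_neq0 _ (unitvec K i));
  rewrite linform_unitvec xi oner_neq0.
by rewrite mulf_eq0 expf_eq0 (negPf x0) (negPf y0).
Qed.

(** Evaluation at the [i]-th unit vector isolates [al]. On the line of points [c e_i + e_k] the form
    [u] is 0 and [q] is 1, which isolates [be] and [ga * nu]; only the term in [ga * mu] then
    remains. *)
Lemma osculating_indep x q u al be ga mu nu i k d :
  x i = 1 -> q i = 0 -> u i = 0 -> q k = 1 -> u k = 0 ->
  al *: linform x ^+ d.+2 + be *: (linform x ^+ d.+1 * linform q)
   + ga *: (mu *: (linform x ^+ d.+1 * linform u)
            + nu *: (linform x ^+ d * linform q ^+ 2)) = 0 ->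
  [/\ al = 0, be = 0, ga * nu = 0 & linform u != 0 -> ga * mu = 0].
Proof.
move=> xi qi ui qk uk E.
have Ev v := congr1 (meval v) E.
have al0 : al = 0.
  have := Ev (unitvec K i).
  rewrite !mevalD !mevalZ !mevalD !mevalZ !mevalM !rmorphXn /= !linform_unitvec.
  by rewrite xi qi ui !expr1n meval0 !(mulr0, addr0, mulr1).
have Es (c : K) : (c + x k) ^+ d * (be * (c + x k) + ga * nu) = 0.
  have := Ev (fun j => c * unitvec K i j + unitvec K k j).
  have L a : (linform a).@[fun j => c * unitvec K i j + unitvec K k j] = c * a
    i + a k.
    rewrite -(linform_unitvec a i) -(linform_unitvec a k) !linform_meval
      mulr_sumr.
    by rewrite -big_split; apply: eq_bigr => j _ /=; rewrite mulrDr mulrCA.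
  rewrite !mevalD !mevalZ !mevalD !mevalZ !mevalM !rmorphXn /= !L meval0.
  rewrite xi qi ui qk uk al0 => E0; rewrite -[RHS]E0 !mulr1 !exprS; ring.
(* At these points [x] takes the values 1 and 2, which gives two independent linear equations for
   [be] and [ga * nu]. *)
have E1 := Es (1 - x k); have E2 := Es (2%:R - x k).
rewrite !subrK expr1n mul1r mulr1 in E1; rewrite subrK in E2.
move/eqP: E2; rewrite mulf_eq0 expf_eq0 pnatr_eq0 andbF /= => /eqP E2.
have be0 : be = 0 by rewrite -[RHS](subrr 0) -{1}E2 -E1; ring.
have gn0 : ga * nu = 0 by rewrite -E1 be0 add0r.
split=> // u0; move/eqP: E;
  rewrite al0 be0 !scale0r !add0r scalerDr !scalerA gn0.
have x0 : linform x != 0.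
  by apply: (@linform_neq0 _ (unitvec K i));
    rewrite linform_unitvec xi oner_neq0.
have xu0 : linform x ^+ d.+1 * linform u != 0 by rewrite mulf_neq0 ?expf_neq0.
by rewrite scale0r addr0 scaler_eq0 (negPf xu0) orbF => /eqP.
Qed.

End Independence.

(** * Reduction of polynomials along a place *)

Lemma big_ord3 (V : nmodType) (f : 'I_3 -> V) :
  \sum_i f i = f ord0 + f (lift ord0 ord0) + f (lift ord0 (lift ord0 ord0)).
Proof. by rewrite !big_ord_recl big_ord0 addr0 addrA. Qed.

Section MPolyPlace.
Variables (K F : fieldType) (iota : {rmorphism K -> F}) (G : F -> K -> Prop).
Hypothesis plG : partial_place iota G.
Variable n : nat.
Implicit Types (P Q : {mpoly F[n]}) (p q : {mpoly K[n]}).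

Definition pl_mpoly P p : Prop := forall m, G P@_m p@_m.

Lemma pl_mpolyC a c : G a c -> pl_mpoly a%:MP c%:MP.
Proof.
move=> Gac m; rewrite !mcoeffC; apply: (plM plG) => //.
by case: (m == 0%MM); [exact: pl1 plG | exact: pl0 plG].
Qed.

Lemma pl_mpolyD P Q p q :
  pl_mpoly P p -> pl_mpoly Q q -> pl_mpoly (P + Q) (p + q).
Proof. by move=> PG QG m; rewrite !mcoeffD; apply: (plD plG). Qed.

Lemma pl_mpolyM P Q p q :
  pl_mpoly P p -> pl_mpoly Q q -> pl_mpoly (P * Q) (p * q).
Proof.
by move=> PG QG m; rewrite !mcoeffM; apply: (pl_sum plG) => j; apply: (plM plG).
Qed.

Lemma pl_mpolyZ a c P p : G a c -> pl_mpoly P p -> pl_mpoly (a *: P) (c *: p).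
Proof. by move=> Gac PG m; rewrite !mcoeffZ; apply: (plM plG). Qed.

Lemma pl_mpoly_sum (I : Type) (r : seq I) (A : pred I)
    (P : I -> {mpoly F[n]}) (p : I -> {mpoly K[n]}) :
  (forall i, pl_mpoly (P i) (p i)) ->
  pl_mpoly (\sum_(i <- r | A i) P i) (\sum_(i <- r | A i) p i).
Proof.
move=> Pp m; rewrite !(raddf_sum (mcoeff m)) /=.
by apply: (pl_sum plG) => i; apply: Pp.
Qed.

Lemma pl_mpolyXn P p k : pl_mpoly P p -> pl_mpoly (P ^+ k) (p ^+ k).
Proof.
move=> Pp; elim: k => [|k IH]; last by rewrite !exprS; apply: pl_mpolyM.
by rewrite !expr0; apply: pl_mpolyC; exact: pl1 plG.
Qed.

Lemma pl_mpoly_linform (V : 'I_n -> F) (v : 'I_n -> K) :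
  (forall i, G (V i) (v i)) -> pl_mpoly (linform V) (linform v).
Proof.
move=> Vv; apply: pl_mpoly_sum => i; apply: pl_mpolyZ => // m.
rewrite !mcoeffX; case: (U_(i)%MM == m); [exact: pl1 plG | exact: pl0 plG].
Qed.

Lemma pl_mpoly_inj P p q : pl_mpoly P p -> pl_mpoly P q -> p = q.
Proof. by move=> Pp Pq; apply/mpolyP => m; apply: (pl_inj plG (Pp m) (Pq m)).
  Qed.

End MPolyPlace.

(** * Limits of linear combinations along a place *)

Section Limits.
Variables (K F : fieldType) (iota : {rmorphism K -> F}) (G : F -> K -> Prop).
Hypothesis plG : place iota G.
Let pG := plG.1.

Lemma place_unit a c : G a c -> c != 0 -> a != 0 /\ G a^-1 c^-1.
Proof.
move=> Gac c0; have a0 : a != 0.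
  apply/eqP => a0; move: c0; rewrite a0 in Gac.
  by rewrite (pl_inj pG Gac (pl0 pG)) eqxx.
split=> //; case: (plG.2 a^-1) => [[e Ge]|].
  have := plM pG Gac Ge; rewrite mulfV // => /(pl_inj pG (pl1 pG)) ce.
  by rewrite -(mulr1 c^-1) ce mulKf.
rewrite invrK => /(pl_inj pG Gac) c00; by rewrite c00 eqxx in c0.
Qed.

(** Divisibility in a valuation ring is total: each new entry is either a multiple of the current
    divisor or replaces it. *)
Lemma exists_divisor (I : finType) (V : I -> F) :
  (forall i, V i = 0) \/ exists2 i0, V i0 != 0 & forall i, exists c,
    G (V i / V i0) c.
Proof.
suff H (s : seq I) : (forall i, i \in s -> V i = 0) \/
    exists2 i0, V i0 != 0 & forall i, i \in s -> exists c, G (V i / V i0) c.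
  case: (H (enum I)) => [V0|[i0 V0 Vi]]; [left|right; exists i0 => //] => i.
    by apply: V0; rewrite mem_enum.
  by apply: Vi; rewrite mem_enum.
elim: s => [|j s [V0|[i0 V0 Vi]]]; first by left.
  have [Vj|Vj] := eqVneq (V j) 0.
    by left=> i; rewrite inE => /orP[/eqP ->|/V0].
  right; exists j => // i; rewrite inE => /orP[/eqP ->|/V0 ->].
    by exists 1; rewrite mulfV //; exact: pl1 pG.
  by exists 0; rewrite mul0r; exact: pl0 pG.
right; case: (plG.2 (V j / V i0)) => [Gj|].
  by exists i0 => // i; rewrite inE => /orP[/eqP ->|/Vi].
rewrite invf_div => Gj.
have [Vj|Vj] := eqVneq (V j) 0.
  exists i0 => // i; rewrite inE => /orP[/eqP ->|/Vi //].
  by exists 0; rewrite Vj mul0r; exact: pl0 pG.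
exists j => // i; rewrite inE => /orP[/eqP ->|/Vi [c Gc]].
  by exists 1; rewrite mulfV //; exact: pl1 pG.
have -> : V i / V j = V i / V i0 * (V i0 / V j) by rewrite mulrA divfK.
by exists (c * 0); apply: (plM pG).
Qed.

(** The coordinate equal to 1 before and after reduction supplies the unit vectors at which
    independence is tested later. A zero family receives [s = 0] and zero [Q] and [q] by
    convention. *)
Lemma primitive_part (I : finType) (V : I -> F) :
  exists s (Q : I -> F) (q : I -> K),
    [/\ forall i, V i = s * Q i, forall i, G (Q i) (q i) &
        [/\ s = 0, forall i, Q i = 0 & forall i, q i = 0] \/
        s != 0 /\ exists2 i, Q i = 1 & q i = 1].
Proof.
case: (exists_divisor V) => [V0|[i0 V0 Vi]].
  exists 0, (fun=> 0), (fun=> 0); split; [|by move=> _; exact: pl0 pG|by left].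
  by move=> i; rewrite V0 mul0r.
have [q Gq] := fin_all_exists Vi.
exists (V i0), (fun i => V i / V i0), q; split=> //.
  by move=> i; rewrite mulrC divfK.
right; split=> //; exists i0; first exact: mulfV.
by apply: (pl_inj pG (Gq i0)); rewrite mulfV //; exact: pl1 pG.
Qed.

(* If some [b i] had no reduction, dividing by the one of largest value would
   give a nontrivial relation between the [be i]. *)
Lemma limit_in_span (I : finType) n (b : I -> F) (B : I -> {mpoly F[n]})
    (be : I -> {mpoly K[n]}) (phi : {mpoly K[n]}) :
  pl_mpoly G (\sum_i b i *: B i) phi -> (forall i, pl_mpoly G (B i) (be i)) ->
  (forall al : I -> K, (forall i, b i = 0 -> al i = 0) ->
     \sum_i al i *: be i = 0 -> forall i, al i = 0) ->
  exists al, phi = \sum_i al i *: be i.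
Proof.
move=> Gphi GB indep; have [s [b' [al [bE Gal dich]]]] := primitive_part b.
have Gsum : pl_mpoly G (\sum_i b' i *: B i) (\sum_i al i *: be i).
  by apply: (pl_mpoly_sum pG) => i; apply: (pl_mpolyZ pG).
have sE : \sum_i b i *: B i = s *: \sum_i b' i *: B i.
  by rewrite scaler_sumr; apply: eq_bigr => i _; rewrite bE scalerA.
case: (plG.2 s) => [[c Gc]|GsV].
  exists (fun i => c * al i).
  have := pl_mpolyZ pG Gc Gsum; rewrite -sE => /(pl_mpoly_inj pG Gphi) ->.
  by rewrite scaler_sumr; apply: eq_bigr => i _; rewrite scalerA.
case: dich => [[s0 _ _]|[s0 [k _ alk]]].
  exists (fun=> 0); rewrite sE s0 scale0r in Gphi.
  rewrite big1 => [|i _]; last by rewrite scale0r.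
  apply: (pl_mpoly_inj pG Gphi) => m; rewrite !mcoeff0; exact: pl0 pG.
have := pl_mpolyZ pG GsV Gphi; rewrite sE scalerA mulVf // scale1r scale0r.
move/(pl_mpoly_inj pG Gsum) => E.
have al0 i : b i = 0 -> al i = 0.
  move/eqP; rewrite bE mulf_eq0 (negPf s0) /= => /eqP b0.
  by apply: (pl_inj pG (Gal i)); rewrite b0; exact: pl0 pG.
have /eqP := indep al al0 E k.
by rewrite alk oner_eq0.
Qed.

Lemma limit_in_span1 n b (B : {mpoly F[n]}) be phi :
  pl_mpoly G (b *: B) phi -> pl_mpoly G B be -> be != 0 ->
  exists al, phi = al *: be.
Proof.
move=> Gphi GB be0.
have [|//|al _|al ->] := @limit_in_span 'I_1 n (fun=> b) (fun=> B) (fun=> be)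
  phi.
- by rewrite big_ord1.
- rewrite big_ord1 => /eqP; rewrite scaler_eq0 (negPf be0) orbF => /eqP al0 i.
  by rewrite (ord1 i).
by exists (al ord0); rewrite big_ord1.
Qed.

(** The implications from [b2 = 0] and [b3 = 0] serve degenerate cases, where a generator occurs
    with coefficient 0 and its reduction may vanish. *)
Lemma limit_in_span3 n b1 b2 b3 (B1 B2 B3 : {mpoly F[n]}) be1 be2 be3 phi :
  pl_mpoly G (b1 *: B1 + b2 *: B2 + b3 *: B3) phi ->
  pl_mpoly G B1 be1 -> pl_mpoly G B2 be2 -> pl_mpoly G B3 be3 ->
  (forall a1 a2 a3, (b2 = 0 -> a2 = 0) -> (b3 = 0 -> a3 = 0) ->
    a1 *: be1 + a2 *: be2 + a3 *: be3 = 0 -> [/\ a1 = 0, a2 = 0 & a3 = 0]) ->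
  exists a1 a2 a3, phi = a1 *: be1 + a2 *: be2 + a3 *: be3.
Proof.
move=> Gphi G1 G2 G3 indep.
pose i1 : 'I_3 := ord0; pose i2 : 'I_3 := lift ord0 ord0.
pose i3 : 'I_3 := lift ord0 (lift ord0 ord0).
have all3 (A : 'I_3 -> Prop) : A i1 -> A i2 -> A i3 -> forall i, A i.
  move=> A1 A2 A3 [[|[|[|//]]] lt]; [move: A1|move: A2|move: A3];
  by congr (A _); apply: val_inj.
pose sel (T : Type) (x1 x2 x3 : T) (i : 'I_3) :=
  if i == i1 then x1 else if i == i2 then x2 else x3.
have [||al al0|al ->] := @limit_in_span 'I_3 n (sel _ b1 b2 b3) (sel _ B1 B2 B3)
   (sel _ be1 be2 be3) phi.
- by rewrite big_ord3.
- exact: all3.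
- rewrite big_ord3 => /indep [||a1 a2 a3]; [exact: (al0 i2)|exact: (al0 i3)|].
  exact: all3.
by exists (al i1), (al i2), (al i3); rewrite big_ord3.
Qed.

End Limits.

(** * Divided differences of powers *)

Definition powsum (R : comNzRingType) (x y : R) (m : nat) : R :=
  \sum_(i < m) x ^+ (m.-1 - i) * y ^+ i.

(** [powsum] and [powsum2] are the first and second divided differences of [T^m]. Written as sums
    instead of quotients, they can be reduced when their arguments have the same reduction. *)
Definition powsum2 (R : comNzRingType) (x y z : R) (m : nat) : R :=
  \sum_(i < m) powsum x y (m.-1 - i) * z ^+ i.

Lemma powsumB (R : comNzRingType) (x y z : R) m :
  powsum x z m - powsum y z m = (x - y) * powsum2 x y z m.
Proof.
rewrite mulr_sumr -sumrB; apply: eq_bigr => i _.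
by rewrite -mulrBl subrXX mulrA.
Qed.

Lemma powsumDX (R : comNzRingType) (x y : R) m :
  (x + y) ^+ m = x ^+ m + y * powsum (x + y) x m.
Proof.
have := subrXX (x + y) x m; rewrite [x + y - x]addrAC subrr add0r => <-.
by rewrite [RHS]addrC subrK.
Qed.

(** In the [la * q] term the divided difference at [x + s * (la * q + t * u)] is exchanged for the
    one at [x + s * q]. These points differ by [s * ((la - 1) * q + t * u)], whence the factors [t]
    and [la - 1] of the correction. *)
Lemma second_difference (R : comNzRingType) (x q u la s t : R) m :
  (x + s * (la * q + t * u)) ^+ m = x ^+ m + s * la * (q * powsum (x + s * q) x
    m)
   + s * (t * (u * powsum (x + s * (la * q + t * u)) x m
               + la * s * (q * u * powsum2 (x + s * (la * q + t * u)) (x + s *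
                 q) x m))
          + s * la * (la - 1) * (q ^+ 2 * powsum2 (x + s * (la * q + t * u)) (x
            + s * q) x m)).
Proof.
rewrite powsumDX; set x3 := x + _; set x2 := x + s * q.
have E := powsumB x3 x2 x m.
have {E} -> : powsum x3 x m = powsum x2 x m + (x3 - x2) * powsum2 x3 x2 x m.
  by rewrite -E [RHS]addrC subrK.
rewrite /x3 /x2; ring.
Qed.

Section PlacePowsum.
Variables (K F : fieldType) (iota : {rmorphism K -> F}) (G : F -> K -> Prop).
Hypothesis pG : partial_place iota G.
Variables (n : nat) (x : {mpoly K[n]}).

Lemma pl_powsum A B m : pl_mpoly G A x -> pl_mpoly G B x ->
  pl_mpoly G (powsum A B m) (m%:R *: x ^+ m.-1).
Proof.
move=> GA GB; have -> : m%:R *: x ^+ m.-1 = \sum_(i < m) x ^+ (m.-1 - i) * x ^+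
  i.
  rewrite scaler_nat -[m in _ *+ m]card_ord -sumr_const; apply: eq_bigr => i _.
  rewrite -exprD subnK //; by case: (m) i => [[]//|k i]; rewrite -ltnS.
by apply: (pl_mpoly_sum pG) => i; apply: (pl_mpolyM pG); apply: (pl_mpolyXn pG).
Qed.

(** The coefficient is the binomial number of [d + 2] over 2, the number of monomials of degree [d]
    in three variables. *)
Lemma pl_powsum2 A B C d : pl_mpoly G A x -> pl_mpoly G B x -> pl_mpoly G C x ->
  pl_mpoly G (powsum2 A B C d.+2) ((\sum_(i < d.+2) (d.+1 - i))%:R *: x ^+ d).
Proof.
move=> GA GB GC; rewrite natr_sum scaler_suml.
apply: (pl_mpoly_sum pG) => i /=.
(* The last summand contains an empty [powsum]; there the exponents [(d.+1 - i).-1] and [i] do not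
   add up to [d]. *)
have [/eqP di|di] := boolP (d.+1 - i == 0)%N.
  rewrite di /powsum big_ord0 mul0r scale0r.
  by move=> m; rewrite !mcoeff0; exact: pl0 pG.
have -> : x ^+ d = x ^+ (d.+1 - i).-1 * x ^+ i.
  have le : (i <= d)%N by move: di; rewrite subn_eq0 -ltnNge.
  by rewrite -exprD subSn //= subnK.
rewrite scalerAl; apply: (pl_mpolyM pG); last exact: (pl_mpolyXn pG).
exact: pl_powsum.
Qed.

End PlacePowsum.

(** * Limits of three powers *)

(** The degree is [d.+2], which avoids truncated subtraction in the exponents. *)
Definition normal_form (K : fieldType) n d (phi : {mpoly K[n]}) : Prop :=
  exists x y z : 'I_n -> K,
  [\/ phi = linform x ^+ d.+2 + linform y ^+ d.+2 + linform z ^+ d.+2,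
      phi = linform x ^+ d.+1 * linform y + linform z ^+ d.+2
    | phi = linform x ^+ d * linform y ^+ 2 + linform x ^+ d.+1 * linform z].

(** Non-proportionality is recorded by a witness point because such points serve as directions of
    differentiation. *)
Definition nonprop (K : fieldType) n (p q : 'I_n -> K) : Prop :=
  exists2 v, (linform p).@[v] = 0 & (linform q).@[v] != 0.

Lemma scale_linformX (K : numClosedFieldType) n c (x : 'I_n -> K) k :
  exists y, c *: linform x ^+ k.+1 = linform y ^+ k.+1.
Proof.
exists (fun i => k.+1.-root c * x i).
by rewrite linformZ exprZn rootCK.
Qed.

Lemma prop_or_nonprop (K : fieldType) n (p q : 'I_n -> K) i j :
  p i = 1 -> q j = 1 ->
  (exists2 c, c != 0 & forall k, q k = c * p k) \/ nonprop p q /\ nonprop q p.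
Proof.
have H (a b : 'I_n -> K) k : a k = 1 ->
  (forall l, b l = b k * a l) \/ nonprop a b.
  move=> ak; have [/forallP E|] := boolP [forall l, b l == b k * a l].
    by left=> l; apply/eqP.
  rewrite negb_forall => /existsP[l bl]; right.
  (* Since [a k = 1], the form [a] vanishes at this point, while [b] takes the value
     [b l - a l * b k], nonzero by the choice of [l]. *)
  exists (fun m => unitvec K l m - a l * unitvec K k m).
    rewrite linform_meval (eq_bigr (fun m => a m * unitvec K l m - a l * (a m *
      unitvec K k m))).
      by rewrite sumrB -mulr_sumr -!linform_meval !linform_unitvec ak mulr1
        subrr.
    by move=> m _; ring.
  rewrite linform_meval (eq_bigr (fun m => b m * unitvec K l m - a l * (b m *
    unitvec K k m))).
    by rewrite sumrB -mulr_sumr -!linform_meval !linform_unitvec subr_eq0 mulrC.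
  by move=> m _; ring.
move=> pi qj; case: (H p q i pi) => [E|npq].
  left; exists (q i) => //; apply/eqP => q0; have := E j.
  by rewrite q0 mul0r qj => /eqP; rewrite oner_eq0.
case: (H q p j qj) => [E|nqp]; last by right.
left; have pj0 : p j != 0.
  apply/eqP => p0; have := E i.
  by rewrite p0 mul0r pi => /eqP; rewrite oner_eq0.
by exists (p j)^-1; rewrite ?invr_eq0 // => k; rewrite (E k) mulKf.
Qed.

Section Cases.
Variables (K : numClosedFieldType) (F : fieldType) (iota : {rmorphism K -> F}).
Variables (G : F -> K -> Prop) (n d : nat).
Hypothesis plG : place iota G.
Let pG := plG.1.
Implicit Types (phi : {mpoly K[n]}).

Lemma limit_distinct (a1 a2 a3 : F) (P1 P2 P3 : 'I_n ->
  F) (p1 p2 p3 : 'I_n -> K) phi :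
  (forall i, G (P1 i) (p1 i)) -> (forall i, G (P2 i) (p2 i)) ->
  (forall i, G (P3 i) (p3 i)) ->
  nonprop p1 p2 -> nonprop p2 p1 -> nonprop p1 p3 -> nonprop p3 p1 ->
  nonprop p2 p3 -> nonprop p3 p2 ->
  pl_mpoly G (a1 *: linform P1 ^+ d.+2 + a2 *: linform P2 ^+ d.+2
              + a3 *: linform P3 ^+ d.+2) phi ->
  normal_form d phi.
Proof.
move=> G1 G2 G3 [v12 v12a v12b] [v21 v21a v21b] [v13 v13a v13b] [v31 v31a v31b]
  [v23 v23a v23b] [v32 v32a v32b] Gphi.
have GX (P : 'I_n -> F) p : (forall i, G (P i) (p i)) ->
    pl_mpoly G (linform P ^+ d.+2) (linform p ^+ d.+2).
  by move=> GP; apply: (pl_mpolyXn pG); apply: (pl_mpoly_linform pG).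
have rot (V : zmodType) (x y z : V) : x + y + z = 0 -> y + z + x = 0.
  by rewrite [y + z + x]addrC addrA.
have swap (V : zmodType) (x y z : V) : x + y + z = 0 -> x + z + y = 0.
  by rewrite addrAC.
have [|c1 [c2 [c3 ->]]] := limit_in_span3 plG Gphi (GX _ _ G1) (GX _ _ G2) (GX
  _ _ G3).
  move=> c1 c2 c3 _ _ E; split.
  - exact: (powers_indep v21a v31a v21b v31b (rot _ _ _ _ E)).
  - exact: (powers_indep v12a v32a v12b v32b (swap _ _ _ _ E)).
  - exact: (powers_indep v13a v23a v13b v23b E).
have [x ->] := scale_linformX c1 p1 d.+1.
have [y ->] := scale_linformX c2 p2 d.+1.
have [z ->] := scale_linformX c3 p3 d.+1.
by exists x, y, z; constructor 1.
Qed.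

Lemma limit_two_equal (a1 a2 a3 s : F) (P Q P3 : 'I_n ->
  F) (p q p3 : 'I_n -> K) i phi :
  (forall j, G (P j) (p j)) -> (forall j, G (Q j) (q j)) ->
  (forall j, G (P3 j) (p3 j)) -> p i = 1 -> q i = 0 -> G s 0 ->
  (s != 0 -> linform q != 0) -> nonprop p p3 ->
  pl_mpoly G (a1 *: linform P ^+ d.+2 + a2 *: (linform P + s *: linform Q) ^+
    d.+2
              + a3 *: linform P3 ^+ d.+2) phi ->
  normal_form d phi.
Proof.
move=> GP GQ G3 pi qi Gs q0 [v va vb] Gphi.
have GP' := pl_mpoly_linform pG GP; have GQ' := pl_mpoly_linform pG GQ.
set X := linform P in Gphi GP' *; set Y := linform Q in Gphi GQ' *.
pose S := powsum (X + s *: Y) X d.+2.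
have GX2 : pl_mpoly G (X + s *: Y) (linform p).
  rewrite -[linform p]addr0 -(scale0r (linform q)).
  by apply: (pl_mpolyD pG) => //; apply: (pl_mpolyZ pG).
have GS : pl_mpoly G S (d.+2%:R *: linform p ^+ d.+1).
  exact: (pl_powsum pG d.+2 GX2 GP').
have E : a1 *: X ^+ d.+2 + a2 *: (X + s *: Y) ^+ d.+2 + a3 *: linform P3 ^+
  d.+2 =
    (a1 + a2) *: X ^+ d.+2 + (a2 * s) *: (S * Y) + a3 *: linform P3 ^+ d.+2.
  rewrite powsumDX -/S -!mul_mpolyC !rmorphD !rmorphM /=; ring.
rewrite E in Gphi.
have [|c1 [c2 [c3 ->]]] := limit_in_span3 plG Gphi (pl_mpolyXn pG d.+2 GP')
   (pl_mpolyM pG GS GQ') (pl_mpolyXn pG d.+2 (pl_mpoly_linform pG G3)).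
  move=> c1 c2 c3 c20 _; rewrite -scalerAl scalerA => Ec.
  have c30 := power_tangent_indep va vb Ec.
  move: Ec; rewrite c30 scale0r addr0 => /(tangent_indep pi qi) [-> H].
  split=> //; have [s0|s0] := eqVneq s 0; first by apply: c20; rewrite s0 mulr0.
  by have /eqP := H (q0 s0); rewrite mulf_eq0 pnatr_eq0 orbF => /eqP.
have [z ->] := scale_linformX c3 p3 d.+1.
(* The first two terms share the factor [linform p ^+ d.+1] and merge into one tangent term. *)
exists p, (fun j => c1 * p j + (c2 * d.+2%:R) * q j), z; constructor 2.
rewrite linformD !linformZ; congr (_ + _).
by rewrite mulrDr -!scalerAr -exprSr -scalerAl scalerA.
Qed.

Lemma limit_three_equal (a1 a2 a3 s : F) (P Q W : 'I_n ->
  F) (p q w : 'I_n -> K) i phi :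
  (forall j, G (P j) (p j)) -> (forall j, G (Q j) (q j)) ->
  (forall j, G (W j) (w j)) -> p i = 1 -> Q i = 0 -> W i = 0 -> G s 0 ->
  (s != 0 -> exists k, Q k = 1) ->
  pl_mpoly G (a1 *: linform P ^+ d.+2 + a2 *: (linform P + s *: linform Q) ^+
    d.+2
              + a3 *: (linform P + s *: linform W) ^+ d.+2) phi ->
  normal_form d phi.
Proof.
move=> GP GQ GW pi Qi Wi Gs sk Gphi.
have GP' := pl_mpoly_linform pG GP; have GQ' := pl_mpoly_linform pG GQ.
have [s0|s0] := eqVneq s 0.
  (* All three forms equal [P] here, so [phi] is a multiple of one power, written as the third
     normal form with second linear form 0. *)
  have := Gphi; rewrite s0 !scale0r !addr0 -!scalerDl => Gphi1.
  have [|c ->] := limit_in_span1 plG Gphi1 (pl_mpolyXn pG d.+2 GP').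
    rewrite expf_neq0 //; apply: (@linform_neq0 _ _ _ (unitvec K i)).
    by rewrite linform_unitvec pi oner_neq0.
  exists p, (fun=> 0), (fun j => c * p j); constructor 3.
  by rewrite (linform0 (a := fun=> 0)) // expr0n mulr0 add0r linformZ -scalerAr
    -exprSr.
have [k Qk] := sk s0.
have qi : q i = 0 by apply: (pl_inj pG (GQ i)); rewrite Qi; exact: pl0 pG.
have qk : q k = 1 by apply: (pl_inj pG (GQ k)); rewrite Qk; exact: pl1 pG.
(* As [Q k = 1], this [la] makes [W - la * Q] vanish at [k]; hence [u] vanishes at both [i] and [k],
   as [osculating_indep] requires. *)
pose la := W k; have Gla : G la (w k) by exact: GW.
have [t [U [u [TE GU dich]]]] := primitive_part plG (fun j => W j - la * Q j).
have Ui0 j : W j - la * Q j = 0 -> u j = 0.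
  rewrite TE; case: dich => [[_ _ -> //]|[t0 _]] /eqP.
  rewrite mulf_eq0 (negPf t0) => /eqP Uj.
  by apply: (pl_inj pG (GU j)); rewrite Uj; exact: pl0 pG.
have ui : u i = 0 by apply: Ui0; rewrite Wi Qi mulr0 subrr.
have uk : u k = 0 by apply: Ui0; rewrite Qk mulr1 subrr.
have GU' := pl_mpoly_linform pG GU.
have WE : linform W = la *: linform Q + t *: linform U.
  rewrite -!linformZ -linformD; apply: eq_linform => j.
  by rewrite -TE addrC subrK.
(* Either coefficient of the second difference may dominate the other. Extracting the common factor
   [h] leaves one of [C true], [C false] equal to 1, unless both coefficients are 0. *)
pose tg (b : bool) := if b then t else s * la * (la - 1).
have [h [C [c [tgE GC hdich]]]] := primitive_part plG tg.
have tE := tgE true; have gE := tgE false; rewrite /= in tE gE.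
set X := linform P in Gphi GP' *; set Y := linform Q in Gphi GQ' WE *.
set V := linform U in GU' WE *.
have GX2 : pl_mpoly G (X + s *: Y) (linform p).
  rewrite -[linform p]addr0 -(scale0r (linform q)).
  by apply: (pl_mpolyD pG) => //; apply: (pl_mpolyZ pG).
have GX3 : pl_mpoly G (X + s *: linform W) (linform p).
  rewrite -[linform p]addr0 -(scale0r (linform w)).
  by apply: (pl_mpolyD pG) => //; apply: (pl_mpolyZ pG) => //;
    exact: (pl_mpoly_linform pG GW).
pose S2 := powsum (X + s *: Y) X d.+2.
pose S3 := powsum (X + s *: linform W) X d.+2.
pose T := powsum2 (X + s *: linform W) (X + s *: Y) X d.+2.
pose N := (\sum_(j < d.+2) (d.+1 - j))%N.
have N0 : N != 0%N by rewrite /N big_ord_recl subn0 addSn.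
have GS2 : pl_mpoly G S2 (d.+2%:R *: linform p ^+ d.+1).
  exact: (pl_powsum pG d.+2 GX2 GP').
have GS3 : pl_mpoly G S3 (d.+2%:R *: linform p ^+ d.+1).
  exact: (pl_powsum pG d.+2 GX3 GP').
have GT : pl_mpoly G T (N%:R *: linform p ^+ d).
  exact: (pl_powsum2 pG d GX3 GX2 GP').
pose C1 := S3 * V + (la * s) *: (Y * V * T); pose C2 := T * Y ^+ 2.
have GC1 : pl_mpoly G C1 (d.+2%:R *: linform p ^+ d.+1 * linform u).
  rewrite -[X in pl_mpoly _ _ X]addr0.
  rewrite -(scale0r (linform q * linform u * (N%:R *: linform p ^+ d))).
  rewrite -[X in X *: (_ * _ * _)](mulr0 (w k)).
  apply: (pl_mpolyD pG); first exact: (pl_mpolyM pG).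
  apply: (pl_mpolyZ pG); first exact: (plM pG).
  by apply: (pl_mpolyM pG) => //; apply: (pl_mpolyM pG).
have GC2 : pl_mpoly G C2 (N%:R *: linform p ^+ d * linform q ^+ 2).
  by apply: (pl_mpolyM pG) => //; apply: (pl_mpolyXn pG).
have E : a1 *: X ^+ d.+2 + a2 *: (X + s *: Y) ^+ d.+2 + a3 *: (X + s *: linform
  W) ^+ d.+2 =
    (a1 + a2 + a3) *: X ^+ d.+2 + (a2 * s + a3 * s * la) *: (S2 * Y)
    + (a3 * s * h) *: (C true *: C1 + C false *: C2).
  have E3 := second_difference X Y V la%:MP s%:MP t%:MP d.+2.
  rewrite !mul_mpolyC -WE -/S2 -/S3 -/T in E3.
  have EC A B : (a3 * s * h) *: (C true *: A + C false *: B) =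
      (a3 * s) *: (t *: A + (s * la * (la - 1)) *: B) :> {mpoly F[n]}.
    by rewrite gE tE !scalerDr !scalerA !mulrA.
  rewrite EC E3 powsumDX -/S2 /C1 /C2 -!mul_mpolyC.
  rewrite !(rmorphD, rmorphM, rmorphB, rmorph1) /=; ring.
rewrite E in Gphi.
have GC3 : pl_mpoly G (C true *: C1 + C false *: C2)
   (c true *: (d.+2%:R *: linform p ^+ d.+1 * linform u)
    + c false *: (N%:R *: linform p ^+ d * linform q ^+ 2)).
  by apply: (pl_mpolyD pG); apply: (pl_mpolyZ pG).
have [|c1 [c2 [c3 ->]]] := limit_in_span3 plG Gphi (pl_mpolyXn pG d.+2 GP')
   (pl_mpolyM pG GS2 GQ') GC3.
  move=> c1 c2 c3 _ c30; rewrite -!scalerAl !scalerA.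
  move/(osculating_indep pi qi ui qk uk) => [-> /eqP c20 /eqP c3q c3u].
  move: c20; rewrite mulf_eq0 pnatr_eq0 orbF => /eqP ->; split=> //.
  (* If [h = 0], the third generator has coefficient 0. If [C true = 1], then [t] is nonzero, so [u]
     is primitive and the tangent term detects [c3]. If [C false = 1], the osculating term does, its
     weight [N] being nonzero. *)
  case: hdich => [[h0 _ _]|[h0 [[] Cb cb]]].
  - by apply: c30; rewrite h0 mulr0.
  - have t0 : t != 0 by rewrite tE Cb mulr1.
    case: dich => [[t00 _ _]|[_ [l _ ul]]]; first by rewrite t00 eqxx in t0.
    have u0 : linform u != 0.
      apply: (@linform_neq0 _ _ _ (unitvec K l)).
      by rewrite linform_unitvec ul oner_neq0.
    by have /eqP := c3u u0; rewrite cb mul1r mulf_eq0 pnatr_eq0 orbF => /eqP.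
  - by move: c3q; rewrite cb mul1r mulf_eq0 pnatr_eq0 (negPf N0) orbF => /eqP.
(* A square root moves the coefficient of the osculating term into [y]; the other terms share
   [linform p ^+ d.+1] and are collected in the last form. *)
have [y yE] := scale_linformX (c3 * (c false * N%:R)) q 1.
exists p, y, (fun j => c1 * p j + (c2 * d.+2%:R) * q j + (c3 * (c true *
  d.+2%:R)) * u j).
constructor 3; rewrite !linformD !linformZ -yE -!mul_mpolyC !rmorphM /= !exprS;
  ring.
Qed.

End Cases.

Section LimitOfThree.
Variables (K : numClosedFieldType) (F : fieldType) (iota : {rmorphism K -> F}).
Variables (G : F -> K -> Prop) (n d : nat).
Hypothesis plG : place iota G.
Let pG := plG.1.
Implicit Types (phi : {mpoly K[n]}).

(** Forms with proportional reductions are normalised to have the same reduction and the same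
    coordinate 1 at [i], so that their differences reduce to 0 and vanish at [i]. Dividing by [P i]
    is harmless because its residue [c] is nonzero. *)
Lemma rescale_residue (P : 'I_n -> F) (p p1 : 'I_n -> K) c i :
  (forall j, G (P j) (p j)) -> c != 0 -> (forall j, p j = c * p1 j) ->
    p1 i = 1 ->
  exists b (P' : 'I_n -> F), [/\ linform P = b *: linform P',
    forall j, G (P' j) (p1 j) & P' i = 1].
Proof.
move=> GP c0 pE pi; have GPi : G (P i) c by have := GP i; rewrite pE pi mulr1.
have [Pi0 GPV] := place_unit plG GPi c0.
exists (P i), (fun j => (P i)^-1 * P j); split; last exact: mulVf.
  by rewrite -linformZ; apply: eq_linform => j; rewrite mulVKf.
by move=> j; have := plM pG GPV (GP j); rewrite pE mulKf.
Qed.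

Lemma limit_pair (a1 a2 a3 : F) (P1 P2 P3 : 'I_n -> F) (p1 p2 p3 : 'I_n ->
  K) c i phi :
  (forall j, G (P1 j) (p1 j)) -> (forall j, G (P2 j) (p2 j)) ->
  (forall j, G (P3 j) (p3 j)) -> P1 i = 1 ->
  c != 0 -> (forall j, p2 j = c * p1 j) -> nonprop p1 p3 ->
  pl_mpoly G (a1 *: linform P1 ^+ d.+2 + a2 *: linform P2 ^+ d.+2
              + a3 *: linform P3 ^+ d.+2) phi ->
  normal_form d phi.
Proof.
move=> G1 G2 G3 P1i c0 pE np Gphi.
have p1i : p1 i = 1 by apply: (pl_inj pG (G1 i)); rewrite P1i; exact: pl1 pG.
have [b [P2' [PE G2' P2i]]] := rescale_residue G2 c0 pE p1i.
have [s [Q [q [QE GQ dich]]]] := primitive_part plG (fun j => P2' j - P1 j).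
have Qi : Q i = 0.
  case: dich => [[_ -> //]|[s0 _]]; apply/eqP; have := QE i.
  by rewrite P2i P1i subrr => /esym/eqP; rewrite mulf_eq0 (negPf s0).
have P2E : linform P2' = linform P1 + s *: linform Q.
  rewrite -linformZ -linformD; apply: eq_linform => j.
  by rewrite -QE [RHS]addrC subrK.
apply: (limit_two_equal plG (s := s) (a1 := a1) (a2 :=
  a2 * b ^+ d.+2) (a3 := a3) G1 GQ G3 p1i _ _ _ np).
- by apply: (pl_inj pG (GQ i)); rewrite Qi; exact: pl0 pG.
(* As [Q k = 1], [s] is itself an entry of the difference [P2' - P1], which reduces to 0. *)
- case: dich => [[-> _ _]|[_ [k Qk _]]]; first exact: pl0 pG.
  by rewrite -(mulr1 s) -Qk -QE -(subrr (p1 k)); apply: (plB pG).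
- case: dich => [[-> _ _]|[_ [k _ qk]] _]; first by rewrite eqxx.
  by apply: (@linform_neq0 _ _ _ (unitvec K k));
    rewrite linform_unitvec qk oner_neq0.
- by rewrite -P2E -scalerA -exprZn -PE.
Qed.

Lemma limit_triple (a1 a2 a3 : F) (P1 P2 P3 : 'I_n -> F) (p1 p2 p3 : 'I_n -> K)
    c2 c3 i phi :
  (forall j, G (P1 j) (p1 j)) -> (forall j, G (P2 j) (p2 j)) ->
  (forall j, G (P3 j) (p3 j)) -> P1 i = 1 ->
  c2 != 0 -> (forall j, p2 j = c2 * p1 j) ->
  c3 != 0 -> (forall j, p3 j = c3 * p1 j) ->
  pl_mpoly G (a1 *: linform P1 ^+ d.+2 + a2 *: linform P2 ^+ d.+2
              + a3 *: linform P3 ^+ d.+2) phi ->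
  normal_form d phi.
Proof.
move=> G1 G2 G3 P1i c20 p2E c30 p3E Gphi.
have p1i : p1 i = 1 by apply: (pl_inj pG (G1 i)); rewrite P1i; exact: pl1 pG.
have [b2 [P2' [PE2 G2' P2i]]] := rescale_residue G2 c20 p2E p1i.
have [b3 [P3' [PE3 G3' P3i]]] := rescale_residue G3 c30 p3E p1i.
(* Both differences must carry the same factor [s], so they are treated as one family. Its
   coordinate equal to 1 lies in one of the two, which then plays the role of [Q]. *)
pose V (bj : bool * 'I_n) := (if bj.1 then P2' else P3') bj.2 - P1 bj.2.
have [s [D [e [DE GD dich]]]] := primitive_part plG V.
have Di b : D (b, i) = 0.
  case: dich => [[_ -> //]|[s0 _]]; apply/eqP; have := DE (b, i).
  by rewrite /V /=; case: b; rewrite ?P2i ?P3i P1i subrr => /esym/eqP;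
    rewrite mulf_eq0 (negPf s0).
have LE b : linform (if b then P2' else P3') = linform P1 + s *: linform (fun j
  => D (b, j)).
  rewrite -linformZ -linformD; apply: eq_linform => j.
  by rewrite -DE [RHS]addrC /V /= subrK.
have Gs : G s 0.
  case: dich => [[-> _ _]|[_ [[b k] Dk _]]]; first exact: pl0 pG.
  rewrite -(mulr1 s) -Dk -DE -(subrr (p1 k)); apply: (plB pG) => //=.
  by case: b {Dk}.
have Gphi' : pl_mpoly G (a1 *: linform P1 ^+ d.+2
    + (a2 * b2 ^+ d.+2) *: (linform P1 + s *: linform (fun j => D (true,
      j))) ^+ d.+2
    + (a3 * b3 ^+ d.+2) *: (linform P1 + s *: linform (fun j => D (false,
      j))) ^+ d.+2) phi.
  rewrite -(LE true) -(LE false) -[(a2 * _) *: _]scalerA -[(a3 * _) *: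
    _]scalerA.
  by rewrite -2!exprZn -PE2 -PE3.
have GDb b j : G (D (b, j)) (e (b, j)) := GD (b, j).
case: dich => [[s0 _ _]|[s0 [[[] k] Dk _]]].
- apply: (limit_three_equal plG G1 (GDb true) (GDb false) p1i (Di _) (Di _) Gs
  _ Gphi').
  by rewrite s0 eqxx.
- apply: (limit_three_equal plG G1 (GDb true) (GDb false) p1i (Di _) (Di _) Gs
  _ Gphi').
  by exists k.
(* The coordinate equal to 1 belongs to the difference of [P3'], so the second and third powers are
   exchanged. *)
- rewrite addrAC in Gphi'.
  apply: (limit_three_equal plG G1 (GDb false) (GDb true) p1i (Di _) (Di _) Gs
    _ Gphi').
  by exists k.
Qed.

Lemma limit_of_three_powers (L1 L2 L3 : 'I_n -> F) phi :
  (exists i, L1 i != 0) -> (exists i, L2 i != 0) -> (exists i, L3 i != 0) ->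
  pl_mpoly G (linform L1 ^+ d.+2 + linform L2 ^+ d.+2 + linform L3 ^+ d.+2) phi
    ->
  normal_form d phi.
Proof.
have prim (L : 'I_n -> F) : (exists i, L i != 0) -> exists a P p i,
    [/\ linform L ^+ d.+2 = a *: linform P ^+ d.+2, forall j, G (P j) (p j),
        P i = 1 & p i = 1].
  move=> [j Lj]; have [s [P [p [LE GP dich]]]] := primitive_part plG L.
  case: dich => [[s0 _ _]|[s0 [i Pi pi]]];
    first by rewrite LE s0 mul0r eqxx in Lj.
  exists (s ^+ d.+2), P, p, i; split=> //.
  by rewrite -exprZn -linformZ; congr (_ ^+ _); apply: eq_linform.
move=> /prim [a1 [P1 [p1 [i1 [-> G1 P1i p1i]]]]].
move=> /prim [a2 [P2 [p2 [i2 [-> G2 P2i p2i]]]]].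
move=> /prim [a3 [P3 [p3 [i3 [-> G3 P3i p3i]]]]] Gphi.
case: (prop_or_nonprop p1i p2i) => [[c c0 cE]|[n12 n21]].
  case: (prop_or_nonprop p1i p3i) => [[c' c0' cE']|[n13 n31]].
    exact: (limit_triple G1 G2 G3 P1i c0 cE c0' cE' Gphi).
  exact: (limit_pair G1 G2 G3 P1i c0 cE n13 Gphi).
case: (prop_or_nonprop p1i p3i) => [[c c0 cE]|[n13 n31]].
  rewrite addrAC in Gphi.
  exact: (limit_pair G1 G3 G2 P1i c0 cE n12 Gphi).
case: (prop_or_nonprop p2i p3i) => [[c c0 cE]|[n23 n32]].
  rewrite -addrA addrC in Gphi.
  exact: (limit_pair G2 G3 G1 P2i c0 cE n21 Gphi).
exact: (limit_distinct plG G1 G2 G3 n12 n21 n13 n31 n23 n32 Gphi).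
Qed.

End LimitOfThree.

(** * Points of the closure *)

Lemma dhomog1_linform (K : fieldType) n (l : dhomog n K 1) :
  (l : {mpoly K[n]}) = linform (fun i => (l : {mpoly K[n]})@_U_(i)).
Proof. exact: (homog1_linform (dhomog_is_dhomog l)). Qed.

Lemma map_linformX (R S : comNzRingType) n (f : {rmorphism R ->
  S}) (a : 'I_n -> R) k :
  map_mpoly f (linform a ^+ k) = linform (fun i => f (a i)) ^+ k.
Proof.
rewrite rmorphXn /= /linform raddf_sum; congr (_ ^+ _);
  apply: eq_bigr => i _ /=.
by rewrite map_mpolyZ map_mpolyX.
Qed.

Section Closure.
Variables (K : numClosedFieldType) (n d : nat).

(** The variables are the entries of a 3 by [n] matrix, whose row [j] holds the coefficients of the
    [j]-th form. *)
Definition generic_form (j : 'I_3) (i : 'I_n) : {mpoly K[3 * n]} :=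
  'X_(mxvec_index j i).

Definition generic_sum : {mpoly {mpoly K[3 * n]}[n]} :=
  \sum_j linform (generic_form j) ^+ d.

Definition generic_coords : #|{: monom n d}|.-tuple {mpoly K[3 * n]} :=
  [tuple generic_sum@_(val (val (enum_val k))) | k < #|{: monom n d}|].

Lemma map_generic_sum (S : comNzRingType) (f : {rmorphism {mpoly K[3 * n]} ->
  S}) :
  map_mpoly f generic_sum = \sum_j linform (fun i => f (generic_form j i)) ^+ d.
Proof.
rewrite raddf_sum; apply: eq_bigr => j _.
exact: map_linformX.
Qed.

Lemma generic_sum_homog : generic_sum \is d.-homog.
Proof.
apply: rpred_sum => j _; have := dhomogMn d (linform_homog (generic_form j)).
by rewrite mul1n.
Qed.

(** Missing forms are filled up with 0, whose [d]-th power is 0 since [d] is positive. *)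
Lemma sum_of_powers_widen (psi : dhomog n K d) s r : (s <= r)%N -> (0 < d)%N ->
  sum_of_powers psi s -> sum_of_powers psi r.
Proof.
move=> sr d0 [l E]; pose l' (k : nat) := if insub k is Some j then l j else 0.
exists (fun j => l' j); rewrite E.
rewrite (eq_bigr (fun j : 'I_s => (l' j : {mpoly K[n]}) ^+ d)); last first.
  by move=> j _; rewrite /l' valK.
rewrite (big_ord_widen r (fun j => (l' j : {mpoly K[n]}) ^+ d) sr) big_mkcond.
apply: eq_bigr => j _; case: ifP => // js; rewrite /l' insubF //.
by rewrite [mpoly_of_dhomog 0]raddf0 expr0n eqn0Ngt d0.
Qed.

Lemma generic_coords_specialize (psi : dhomog n K d) :
  (0 < d)%N -> rank_at_most 3 psi ->
  exists xi, forall k, coords psi k = (tnth generic_coords k).@[xi].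
Proof.
move=> d0 [s s3 [/(sum_of_powers_widen s3 d0) [l E] _]].
pose xi k := mxvec (\matrix_(j < 3, i < n) (l j : {mpoly K[n]})@_U_(i)) 0 k.
exists xi => k; rewrite /coords tnth_mktuple -(mcoeff_map_mpoly (meval xi)).
rewrite map_generic_sum E; congr (_@__); apply: eq_bigr => j _.
rewrite {1}(dhomog1_linform (l j)); congr (_ ^+ _); apply: eq_linform => i.
by rewrite /= mevalXU /xi mxvecE mxE.
Qed.

(** The graph of evaluation at [phi] on the algebra generated by the coordinates of the generic
    sum. *)
Definition closure_relation (phi : dhomog n K d)
    (a : {fraction {mpoly K[3 * n]}}) (c : K) : Prop :=
  exists P : {mpoly K[#|{: monom n d}|]},
    a = FracField.tofrac (P \mPo generic_coords) /\ c = P.@[coords phi].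

Definition const_frac : {rmorphism K -> {fraction {mpoly K[3 * n]}}} :=
  @FracField.tofrac _ \o @mpolyC (3 * n) K.

(** A polynomial vanishing at the generic coordinates vanishes, by specialization, on all forms of
    rank at most three, hence at [phi]; so 0 cannot have residue 1. *)
Lemma closure_partial_place (phi : dhomog n K d) :
  (0 < d)%N -> zariski_closure (rank_at_most 3) phi ->
  partial_place const_frac (closure_relation phi).
Proof.
move=> d0 clphi; split.
- by move=> c; exists c%:MP; rewrite comp_mpolyC mevalC.
- move=> _ _ _ _ [P [-> ->]] [Q [-> ->]]; exists (P + Q).
  by rewrite comp_mpolyD mevalD tofracD.
- move=> _ _ _ _ [P [-> ->]] [Q [-> ->]]; exists (P * Q).
  by rewrite rmorphM mevalM tofracM.
move=> [P [/esym/eqP]]; rewrite tofrac_eq0 => /eqP P0.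
rewrite clphi => [/eqP|psi /(generic_coords_specialize d0) [xi xiE]].
  by rewrite oner_eq0.
by rewrite (meval_eq _ xiE) -comp_mpoly_meval P0 meval0.
Qed.

End Closure.

Lemma closure_normal_form (K : numClosedFieldType) n d (phi : dhomog n K d.+2) :
  zariski_closure (rank_at_most 3) phi -> normal_form d (phi : {mpoly K[n]}).
Proof.
move=> clphi; have hphi := dhomog_is_dhomog phi.
(* Without variables the generic forms would be 0; there [phi] is 0, having positive degree. *)
case: n phi clphi hphi => [|n] phi clphi hphi.
  have -> : (phi : {mpoly K[0]}) = 0.
    apply/mpolyP => m; rewrite mcoeff0 (dhomog_nemf_coeff hphi) //.
    by rewrite /= mdegE big_ord0.
  exists (fun=> 0), (fun=> 0), (fun=> 0); constructor 1.
  by rewrite linform0 // expr0n !addr0.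
have [G plG subG] := place_extension (closure_partial_place (ltn0Sn _) clphi).
pose L j i : {fraction {mpoly K[3 * n.+1]}} :=
  FracField.tofrac (generic_form K j i).
have L0 j : exists i, L j i != 0.
  exists ord0; rewrite tofrac_eq0;
    apply/eqP => /(congr1 (mcoeff U_(mxvec_index j ord0))).
  by rewrite mcoeffXU eqxx mcoeff0 => /eqP; rewrite oner_eq0.
pose i1 : 'I_3 := ord0; pose i2 : 'I_3 := lift ord0 ord0.
pose i3 : 'I_3 := lift ord0 (lift ord0 ord0).
apply: (limit_of_three_powers plG (L0 i1) (L0 i2) (L0 i3)) => m.
have -> : linform (L i1) ^+ d.+2 + linform (L i2) ^+ d.+2 + linform (L i3) ^+
  d.+2
    = map_mpoly (@FracField.tofrac {mpoly K[3 * n.+1]}) (generic_sum K n.+1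
      d.+2).
  have E : map_mpoly (@FracField.tofrac {mpoly K[3 * n.+1]}) (generic_sum K
    n.+1 d.+2)
    = \sum_j linform (L j) ^+ d.+2 := map_generic_sum _ _.
  by rewrite E big_ord3.
rewrite mcoeff_map_mpoly; have [dm|dm] := boolP (mdeg m == d.+2).
  have lt : (mdeg m < d.+3)%N by rewrite (eqP dm).
  pose k := enum_rank (Sub (BMultinom lt) dm : monom n.+1 d.+2).
  (* The variable ['X_k] reads off the coefficient at [m] of both the generic sum and [phi]. *)
  apply: subG; exists 'X_k; rewrite comp_mpolyXU mevalXU /coords.
  by rewrite -tnth_nth tnth_mktuple enum_rankK.
rewrite (dhomog_nemf_coeff hphi) // (dhomog_nemf_coeff (generic_sum_homog _ _
  _) dm).
change (G (FracField.tofrac (0 : {mpoly K[3 * n.+1]})) 0).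
by rewrite tofrac0; exact: (pl0 plG.1).
Qed.

(** * Ranks *)

Section Univariate.
Variable K : numFieldType.

Lemma poly_eq0_on_field (p : {poly K}) : (forall t, p.[t] = 0) -> p = 0.
Proof.
move=> p0; apply/eqP/negP => /negP nz.
have := @max_poly_roots _ p [seq k%:R | k <- iota 0 (size p)] nz.
rewrite size_map size_iota ltnn map_inj_uniq ?iota_uniq; last first.
  by move=> i j /eqP; rewrite eqr_nat => /eqP.
by move=> H; have : false by apply: H => //; apply/allP => t _; apply/rootP.
Qed.

Lemma coef_affineX (a b : K) D k :
  ((a%:P + b *: 'X) ^+ D)`_k = a ^+ (D - k) * b ^+ k *+ 'C(D, k).
Proof.
have -> : (a%:P + b *: 'X) ^+ D =
    \poly_(i < D.+1) (a ^+ (D - i) * b ^+ i *+ 'C(D, i)).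
  rewrite exprDn poly_def; apply: eq_bigr => i _.
  by rewrite -scalerMnl exprZn -polyC_exp mul_polyC scalerA.
rewrite coef_poly ltnS; case: leqP => // lt.
by rewrite bin_small.
Qed.

(* A monic polynomial of degree [D - 1] vanishing at all [a j / b j] pairs to
   zero with the moments of the points, whereas the identity says that only
   its leading coefficient contributes, with a nonzero weight. *)
Lemma affine_power_sum_lower D r (a b : 'I_r -> K) : (2 <= D)%N ->
  (forall t, t = \sum_j (a j + b j * t) ^+ D) -> (D <= r)%N.
Proof.
move=> D2 H.
have EX : 'X = \sum_j ((a j)%:P + b j *: 'X) ^+ D.
  apply/eqP; rewrite -subr_eq0; apply/eqP/poly_eq0_on_field => t.
  rewrite hornerD hornerN hornerX horner_sum {1}(H t) -sumrB big1 // => j _.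
  by rewrite horner_exp hornerD hornerC hornerZ hornerX subrr.
pose M k := \sum_j a j ^+ (D - k) * b j ^+ k.
have ME k : (k == 1)%:R = M k *+ 'C(D, k).
  rewrite -coefX EX coef_sum -sumrMnl; apply: eq_bigr => j _.
  exact: coef_affineX.
rewrite leqNgt; apply/negP => rD.
(* Where [b j = 0] this is 0 by convention. Only moments [M (D - i)] with [i < D] are used, and such
   points contribute 0 to them. *)
pose u j := a j / b j.
pose q : {poly K} := 'X^(D.-1 - r) * \prod_j ('X - (u j)%:P).
have qmon : q \is monic.
  by rewrite monicMl ?monicXn // monic_prod // => j _; exact: monicXsubC.
have sq : size q = D.
  rewrite /q size_monicM ?monicXn ?monic_neq0 //; last first.
    by apply: monic_prod => j _; exact: monicXsubC.
  rewrite size_polyXn size_prod_XsubC /index_enum -enumT size_enum_ord addSn /=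
    addnS.
  by rewrite subnK ?prednK ?(ltnW D2) // -ltnS prednK // ltnW.
have qu j : q.[u j] = 0.
  rewrite hornerM horner_prod (bigD1 j) //= hornerD hornerN hornerX hornerC.
  by rewrite subrr mul0r mulr0.
have : \sum_(i < D) q`_i * M (D - i)%N = 0.
  rewrite (eq_bigr (fun i : 'I_D => \sum_j b j ^+ D * (q`_i * u j ^+ i)));
    last first.
    move=> i _; rewrite mulr_sumr; apply: eq_bigr => j _.
    have iD := ltnW (ltn_ord i); rewrite [RHS]mulrCA (subKn iD); congr (_ * _).
    rewrite /u exprMn [RHS]mulrCA; congr (_ * _).
    have [->|b0] := eqVneq (b j) 0.
      by rewrite !expr0n subn_eq0 leqNgt ltn_ord /= eqn0Ngt (ltnW D2) mul0r.
    by rewrite exprMVB.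
  rewrite exchange_big big1 //= => j _.
  by have := horner_coef q (u j); rewrite sq qu -mulr_sumr => <-; rewrite mulr0.
have D1 : (D.-1 < D)%N by rewrite prednK // ltnW.
rewrite (bigD1 (Ordinal D1)) //= big1 ?addr0 => [|i iD].
  have -> : q`_D.-1 = 1 by have /monicP := qmon; rewrite lead_coefE sq.
  rewrite mul1r -subn1 subKn ?(ltnW D2) // => M1.
  by have := ME 1%N; rewrite M1 mul0rn => /eqP; rewrite oner_eq0.
have := ME (D - i)%N; have -> : (D - i == 1)%N = false.
  apply: contraNF iD => /eqP Di; apply/eqP/val_inj => /=.
  by rewrite -subn1 -Di subKn // ltnW.
move/esym/eqP; rewrite mulrn_eq0 -leqn0 leqNgt bin_gt0 leq_subr /= => /eqP ->.
by rewrite mulr0.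
Qed.

Lemma vandermonde_solve m (t b : 'I_m -> K) : injective t ->
  exists a : 'I_m -> K, forall k : 'I_m, \sum_j a j * t j ^+ k = b k.
Proof.
move=> tinj; pose V := Vandermonde m (\row_j t j).
have Vu : V \in unitmx.
  rewrite unitmxE det_Vandermonde unitfE; apply/prodf_neq0 => i _.
  apply/prodf_neq0 => j ij; rewrite !mxE subr_eq0; apply/eqP => /tinj ji.
  by rewrite ji ltnn in ij.
exists (fun j => (invmx V *m \col_k b k) j 0) => k.
have := congr1 (fun A : 'cV_m => A k 0) (mulKVmx Vu (\col_k b k)).
rewrite /= [RHS]mxE => <-; rewrite [RHS]mxE; apply: eq_bigr => j _.
by rewrite mulrC /V !mxE.
Qed.

(** With [D - k + 1] nodes the moments of orders [k] to [D] can be prescribed, which removes the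
    terms of degree above [k] in [y]. The terms of lower degree stay uncontrolled and are absorbed
    later by changing the linear forms. *)
Lemma binary_power_interpolation (A : comAlgType K) D k : (k <= D)%N ->
  exists (a t : 'I_(D - k).+1 -> K) (c : nat -> K),
    [/\ c k = 1, forall i, (k < i <= D)%N -> c i = 0 &
     forall x y : A, \sum_j a j *: (x + t j *: y) ^+ D
       = \sum_(i < D.+1) c i *: (x ^+ (D - i) * y ^+ i)].
Proof.
move=> kD; pose t (j : 'I_(D - k).+1) : K := j.+1%:R.
have t0 j : t j != 0 by rewrite pnatr_eq0.
have tinj : injective t.
  by move=> i j /eqP; rewrite eqr_nat eqSS => /eqP; exact: val_inj.
have [a' aE] := vandermonde_solve
  (fun l : 'I_(D - k).+1 => if l == 0 :> nat then ('C(D, k)%:R)^-1 else 0) tinj.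
(* This shifts the moments of orders [k] to [D] of [a] to those of orders 0 to [D - k] of [a'],
   which a square Vandermonde system prescribes. *)
pose a j := a' j / t j ^+ k.
pose c i := (\sum_j a j * t j ^+ i) * 'C(D, i)%:R.
have cE i : (k <= i)%N -> c i = (\sum_j a' j * t j ^+ (i - k)) * 'C(D, i)%:R.
  move=> ki; congr (_ * _); apply: eq_bigr => j _.
  by rewrite /a -{1}(subnK ki) exprD [t j ^+ (i - k) * _]mulrC mulrA divfK //
    expf_neq0.
exists a, t, c; split.
- rewrite cE // subnn; have := aE ord0; rewrite /= => ->.
  by rewrite mulVf // pnatr_eq0 -lt0n bin_gt0.
- move=> i /andP[ki iD]; rewrite (cE _ (ltnW ki)).
  have lt : (i - k < (D - k).+1)%N by rewrite ltnS leq_sub2r.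
  have := aE (Ordinal lt); rewrite /= => ->.
  by rewrite subn_eq0 leqNgt ki mul0r.
move=> x y; under eq_bigr do rewrite exprDn scaler_sumr.
rewrite exchange_big; apply: eq_bigr => i _ /=.
rewrite /c mulr_suml scaler_suml; apply: eq_bigr => j _.
by rewrite exprZn -scalerAr -scaler_nat !scalerA; congr (_ *: _); ring.
Qed.

End Univariate.

(** * Explicit power sums and the reduction of lower bounds to one variable *)

Section PowerSums.
Variables (K : numClosedFieldType) (n : nat).
Implicit Types (p q : {mpoly K[n]}) (x y z v w : 'I_n -> K).

Definition power_sum D r p : Prop :=
  exists l : 'I_r -> 'I_n -> K, p = \sum_j linform (l j) ^+ D.

Lemma power_sumP D r (phi : dhomog n K D) :
  sum_of_powers phi r <-> power_sum D r (phi : {mpoly K[n]}).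
Proof.
split=> [[l ->]|[l E]].
  exists (fun j i => (l j : {mpoly K[n]})@_U_(i)); apply: eq_bigr => j _.
  by rewrite -dhomog1_linform.
by exists (fun j => DHomog (linform_homog (l j))).
Qed.

Lemma power_sumD D r s p q :
  power_sum D r p -> power_sum D s q -> power_sum D (r + s) (p + q).
Proof.
move=> [l ->] [m ->].
exists (fun j => match split j with inl i => l i | inr i => m i end).
rewrite big_split_ord; congr (_ + _); apply: eq_bigr => j _.
  by case: split_ordP => i /eqP; rewrite ?eq_lrshift // eq_lshift => /eqP ->.
by case: split_ordP => i /eqP; rewrite ?eq_rlshift // eq_rshift => /eqP ->.
Qed.

Lemma power_sum1 d x : power_sum d 1 (linform x ^+ d).
Proof. by exists (fun=> x); rewrite big_ord1. Qed.

Lemma power_sum_comb D r (a t : 'I_r -> K) x y :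
  power_sum D.+1 r (\sum_j a j *: (linform x + t j *: linform y) ^+ D.+1).
Proof.
have H j : exists l, a j *: (linform x + t j *: linform y) ^+ D.+1 = linform l
  ^+ D.+1.
  rewrite -linformZ -linformD; exact: scale_linformX.
have [l lE] := fin_all_exists H.
by exists l; apply: eq_bigr => j _; rewrite lE.
Qed.

Lemma tangent_power_sum d x y :
  power_sum d.+2 d.+2 (linform x ^+ d.+1 * linform y).
Proof.
have [a [t [c [c1 c0 E]]]] :=
  @binary_power_interpolation K {mpoly K[n]} d.+2 1 isT.
rewrite subn1 in a t E.
(* The interpolation leaves an extra multiple [c 0] of the pure power of [x]; subtracting [c 0]
   times [x] from [y] cancels it. *)
pose y' i := y i + - c 0%N * x i.
have y'E : linform y' = linform y - c 0%N *: linform x.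
  by rewrite linformD linformZ scaleNr.
have -> : linform x ^+ d.+1 * linform y =
    \sum_j a j *: (linform x + t j *: linform y') ^+ d.+2.
  rewrite E big_ord_recl big_ord_recl big1 ?addr0; last first.
    by move=> i _; rewrite c0 ?scale0r //= ltnS ltn_ord.
  rewrite /= c1 subn0 subn1 /= y'E expr0 mulr1 expr1 scale1r mulrBr addrC.
  by rewrite -scalerAr -exprSr subrK.
exact: power_sum_comb.
Qed.

(** Interpolation with [k = 2] needs only [d.+1] powers. The leftover terms are divisible by
    [linform x ^+ d.+1], so the last form of the third normal form can absorb them. *)
Lemma osculating_power_sum d x y : exists c0 c1,
  power_sum d.+2 d.+1 (linform x ^+ d * linform y ^+ 2
    + (c1 *: (linform x ^+ d.+1 * linform y) + c0 *: linform x ^+ d.+2)).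
Proof.
have [a [t [c [c2 cz E]]]] :=
  @binary_power_interpolation K {mpoly K[n]} d.+2 2 isT.
rewrite !subSS subn0 in a t E.
exists (c 0%N), (c 1%N).
have -> : linform x ^+ d * linform y ^+ 2
    + (c 1%N *: (linform x ^+ d.+1 * linform y) + c 0%N *: linform x ^+ d.+2)
    = \sum_j a j *: (linform x + t j *: linform y) ^+ d.+2.
  rewrite E 3!big_ord_recl big1 ?addr0; last first.
    by move=> i _; rewrite cz ?scale0r //= !ltnS ltn_ord.
  rewrite /= c2 !subSS !subn0 expr0 mulr1 expr1 scale1r.
  by rewrite [RHS]addrA [RHS]addrC; congr (_ + _); exact: addrC.
exact: power_sum_comb.
Qed.

(** On the given line each linear form becomes an affine function of [t], which reduces the bound to
    [affine_power_sum_lower]. *)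
Lemma power_sum_lower d r p v w : power_sum d.+2 r p ->
  (forall t, p.@[fun i => v i + t * w i] = t) -> (d.+2 <= r)%N.
Proof.
move=> [l ->] H.
apply: (affine_power_sum_lower (a := fun j => (linform (l j)).@[v])
  (b := fun j => (linform (l j)).@[w])) => // t.
rewrite -{1}(H t) raddf_sum; apply: eq_bigr => j _ /=.
rewrite rmorphXn /= linform_meval !(linform_meval (l j)); congr (_ ^+ _).
by rewrite mulr_suml -big_split; apply: eq_bigr => i _ /=; ring.
Qed.

(** The points are the columns of a right inverse of the coefficient matrix, whose rows are
    independent. *)
Lemma dual_points (x y z : dhomog n K 1) : lin_indep3 x y z ->
  exists v : 'I_3 -> 'I_n -> K, forall j,
    [/\ (x : {mpoly K[n]}).@[v j] = (j == ord0)%:R,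
        (y : {mpoly K[n]}).@[v j] = (j == lift ord0 ord0)%:R &
        (z : {mpoly K[n]}).@[v j] = (j == lift ord0 (lift ord0 ord0))%:R].
Proof.
move=> indep.
pose i1 : 'I_3 := ord0; pose i2 : 'I_3 := lift ord0 ord0.
pose i3 : 'I_3 := lift ord0 (lift ord0 ord0).
pose l (i : 'I_3) := if i == i1 then x else if i == i2 then y else z.
pose A := \matrix_(i < 3, j < n) (l i : {mpoly K[n]})@_U_(j).
have Afree : row_free A.
  apply: inj_row_free => r rA.
  have [|r1 r2 r3] := indep (r 0 i1) (r 0 i2) (r 0 i3).
    apply/val_inj.
    change (r 0 i1 *: (x : {mpoly K[n]}) + r 0 i2 *: (y : {mpoly K[n]})
            + r 0 i3 *: (z : {mpoly K[n]}) = 0).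
    rewrite (dhomog1_linform x) (dhomog1_linform y) (dhomog1_linform z).
    rewrite -!linformZ -!linformD; apply: linform0 => j.
    by have := congr1 (fun M : 'rV_n => M 0 j) rA;
      rewrite /= !mxE big_ord3 !mxE.
  apply/rowP => i; rewrite mxE; case: (unliftP ord0 i) => [j ->|-> //].
  by case: (unliftP ord0 j) => [k ->|-> //]; rewrite (ord1 k).
have [B AB] := row_freeP Afree.
exists (fun j k => B k j) => j.
have H i : (l i : {mpoly K[n]}).@[fun k => B k j] = (j == i)%:R.
  rewrite (dhomog1_linform (l i)) linform_meval eq_sym.
  have := congr1 (fun M : 'M_3 => M i j) AB; rewrite /= !mxE => <-.
  by apply: eq_bigr => k _; rewrite mxE.
by split; [exact: (H i1)|exact: (H i2)|exact: (H i3)].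
Qed.

Lemma is_rank_between D (phi : dhomog n K D) a b :
  power_sum D b (phi : {mpoly K[n]}) ->
  (forall r, power_sum D r (phi : {mpoly K[n]}) -> (a <= r)%N) ->
  exists2 r, is_rank phi r & (a <= r <= b)%N.
Proof.
move=> hb ha.
have ex : exists r, boolp.asbool (sum_of_powers phi r).
  by exists b; apply/boolp.asboolP/power_sumP.
case: (ex_minnP ex) => r /boolp.asboolP Pr min; exists r.
  by split=> // s Ps; apply: min; apply/boolp.asboolP.
rewrite ha /=; last exact/power_sumP.
by apply: min; apply/boolp.asboolP/power_sumP.
Qed.

End PowerSums.

Lemma dhomog1_meval (K : fieldType) n (l : dhomog n K 1) (v w : 'I_n -> K) t :
  (l : {mpoly K[n]}).@[fun i => v i + t * w i] =
  (l : {mpoly K[n]}).@[v] + t * (l : {mpoly K[n]}).@[w].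
Proof.
rewrite (dhomog1_linform l) !linform_meval mulr_sumr -big_split.
by apply: eq_bigr => i _ /=; ring.
Qed.

Section Ranks.
Variables (K : numClosedFieldType) (n d : nat) (phi : dhomog n K d.+2).
Implicit Types x y z : dhomog n K 1.

Lemma exists_normal_form : zariski_closure (rank_at_most 3) phi ->
  exists x y z : dhomog n K 1,
     [\/ (phi : {mpoly K[n]}) = nf1 d.+2 x y z,
       (phi : {mpoly K[n]}) = nf2 d.+2 x y z
       | (phi : {mpoly K[n]}) = nf3 d.+2 x y z].
Proof.
move=> /closure_normal_form [x [y [z E]]].
exists (DHomog (linform_homog x)), (DHomog (linform_homog y)),
  (DHomog (linform_homog z)).
by rewrite /nf1 /nf2 /nf3 !subSS !subn0.
Qed.

(** A set lies in its Zariski closure, so the border rank bounds the rank from below; the normal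
    form itself gives the upper bound. *)
Lemma nf1_rank x y z : is_border_rank phi 3 ->
  (phi : {mpoly K[n]}) = nf1 d.+2 x y z -> is_rank phi 3.
Proof.
move=> [_ min] E.
have [|r rk /andP[r0 r3]] :=
  @is_rank_between K n d.+2 phi 0 3 _ (fun _ _ => leq0n _).
  rewrite E /nf1 (dhomog1_linform x) (dhomog1_linform y) (dhomog1_linform z).
  by apply: (@power_sumD K n d.+2 2 1); first apply: (@power_sumD K n d.+2 1 1);
    exact: power_sum1.
suff -> : 3%N = r by [].
apply/eqP; rewrite eqn_leq r3 andbT; apply: min => P; apply.
by exists r.
Qed.

Lemma nf2_rank x y z : lin_indep3 x y z ->
  (phi : {mpoly K[n]}) = nf2 d.+2 x y z ->
  exists2 r, is_rank phi r & (d.+2 <= r <= d.+2 + 1)%N.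
Proof.
move=> /dual_points [v vE] E; apply: is_rank_between.
  rewrite E /nf2 (dhomog1_linform x) (dhomog1_linform y) (dhomog1_linform z).
  by apply: power_sumD; [rewrite subn1;
    exact: tangent_power_sum|exact: power_sum1].
(* On this line [x = 1], [y = t] and [z = 0]. *)
move=> r pr; apply: (power_sum_lower (v := v ord0) (w :=
  v (lift ord0 ord0)) pr) => t.
rewrite E /nf2 mevalD mevalM !rmorphXn /= !dhomog1_meval.
have [-> -> ->] := vE ord0; have [-> -> ->] := vE (lift ord0 ord0).
by rewrite /= !(mulr0, addr0, add0r, mulr1) expr1n expr0n mul1r addr0.
Qed.

Lemma nf3_rank x y z : lin_indep3 x y z ->
  (phi : {mpoly K[n]}) = nf3 d.+2 x y z ->
  exists2 r, is_rank phi r & (d.+2 <= r <= 2 * d.+2 - 1)%N.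
Proof.
move=> /dual_points [v vE] E; apply: is_rank_between.
  rewrite E /nf3 (dhomog1_linform x) (dhomog1_linform y) (dhomog1_linform z).
  set x' := fun i => _; set y' := fun i => _; set z' := fun i => _.
  have [c0 [c1 ps]] := osculating_power_sum d x' y'.
  (* Subtracting the leftover terms of the osculating power sum from [z'] gives a total of
     [d.+1 + d.+2] powers. *)
  have := tangent_power_sum d x' (fun i => z' i + ((- c1) * y' i + (- c0) * x'
    i)).
  rewrite !linformD !linformZ => /(power_sumD ps).
  have -> : (2 * d.+2 - 1 = d.+1 + d.+2)%N by rewrite mul2n -addnn addSn subn1.
  rewrite !subSS !subn0; congr power_sum.
  rewrite -!mul_mpolyC !rmorphN /= !exprS; ring.
move=> r pr.
(* On this line [x = 1], [y = 0] and [z = t]. *)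
apply: (power_sum_lower (v := v ord0) (w :=
  v (lift ord0 (lift ord0 ord0))) pr) => t.
rewrite E /nf3 mevalD !mevalM !rmorphXn /= !dhomog1_meval.
have [-> -> ->] := vE ord0; have [-> -> ->] := vE (lift ord0 (lift ord0 ord0)).
by rewrite /= !(mulr0, addr0, add0r, mulr1) expr1n mul1r.
Qed.

End Ranks.

Theorem theorem1p2 (R : realType) (n d : nat) (phi : dhomog n R[i] d) :
  (2 <= d)%N ->
  is_border_rank phi 3 ->
  (exists x y z : dhomog n R[i] 1,
     [\/ (phi : {mpoly R[i][n]}) = nf1 d x y z,
         (phi : {mpoly R[i][n]}) = nf2 d x y z
       | (phi : {mpoly R[i][n]}) = nf3 d x y z])
  /\
  (forall x y z : dhomog n R[i] 1, lin_indep3 x y z ->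
     [/\ (phi : {mpoly R[i][n]}) = nf1 d x y z -> is_rank phi 3,
         (phi : {mpoly R[i][n]}) = nf2 d x y z ->
           exists2 r, is_rank phi r & (d <= r <= d + 1)%N
       & (phi : {mpoly R[i][n]}) = nf3 d x y z ->
           exists2 r, is_rank phi r & (d <= r <= 2 * d - 1)%N]).
Proof.
case: d phi => [|[|d]] // phi _ br; split;
  first exact: (exists_normal_form br.1).
move=> x y z xyz; split.
- exact: (nf1_rank br).
- exact: (nf2_rank xyz).
- exact: (nf3_rank xyz).
Qed.
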